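(* Let $\sigma\in\{-1,0,1\}$ and $\omega_L\vee\omega_R>0$. For all $n\in\mathbb N$ and $x_1,\dots,x_n\in V$ with $x_i\neq x_j$ if $i\ne j$, let $\kappa(\delta_{x_1}+\cdots+\delta_{x_n})$ denote the joint cumulant, under the stationary measure $\mu_{\theta_L,\theta_R}$, of the random variables $\frac{\eta(x_i)}{\alpha_{x_i}}-\bar\theta_{x_i}$, $i=1,\dots,n$. Then there is a real number $\varphi(\delta_{x_1}+\cdots+\delta_{x_n})$, depending on neither $\theta_L$ nor $\theta_R$ but only on $\sigma$ and the underlying geometry (the parameters $\omega_{\{x,y\}}$, $\alpha_x$, $\omega_L,\omega_R,\alpha_L,\alpha_R$) and on $x_1,\dots,x_n$, such that for all $\theta_L,\theta_R\in\Theta$ $$\kappa(\delta_{x_1}+\cdots+\delta_{x_n})=(\theta_L-\theta_R)^n\,\varphi(\delta_{x_1}+\cdots+\delta_{x_n}).$$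
   Context: Setting. $\mathbb N=\{1,2,\dots\}$, $\mathbb N_0=\mathbb N\cup\{0\}$. Let $N\in\mathbb N$, $V=\{1,\dots,N\}$. Symmetric conductances $\omega_{\{x,y\}}\in[0,\infty)$, $x,y\in V$, with $\omega_{\{x,x\}}=0$; write $x\sim y$ if $\omega_{\{x,y\}}\neq0$ and assume the graph $(V,\sim)$ is connected. Site parameters $\alpha_x\in\mathbb N$. Boundary parameters $\omega_L,\omega_R\ge0$, $\alpha_L,\alpha_R>0$. $\Theta=[0,1]$ if $\sigma=-1$ and $\Theta=[0,\infty)$ if $\sigma\in\{0,1\}$; $\theta_L,\theta_R\in\Theta$. Boundary driven process. $\mathcal X=\prod_{x\in V}\{0,\dots,\alpha_x\}$ if $\sigma=-1$, $\mathcal X=\mathbb N_0^V$ otherwise. $\{\eta_t\}$ is the Markov process on $\mathcal X$ with generator $\mathcal L=\sum_{\{x,y\}:x\sim y}\omega_{\{x,y\}}\mathcal L_{\{x,y\}}+\omega_L\mathcal L_L+\omega_R\mathcal L_R$ (sum over unordered pairs), where $\mathcal L_{\{x,y\}}f(\eta)=\eta(x)(\alpha_y+\sigma\eta(y))(f(\eta-\delta_x+\delta_y)-f(\eta))+\eta(y)(\alpha_x+\sigma\eta(x))(f(\eta-\delta_y+\delta_x)-f(\eta))$, $\mathcal L_Lf(\eta)=\eta(1)\alpha_L(1+\sigma\theta_L)(f(\eta-\delta_1)-f(\eta))+\alpha_L\theta_L(\alpha_1+\sigma\eta(1))(f(\eta+\delta_1)-f(\eta))$, $\mathcal L_Rf(\eta)=\eta(N)\alpha_R(1+\sigma\theta_R)(f(\eta-\delta_N)-f(\eta))+\alpha_R\theta_R(\alpha_N+\sigma\eta(N))(f(\eta+\delta_N)-f(\eta))$.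 For $\omega_L\vee\omega_R>0$ the process has a unique stationary measure $\mu_{\theta_L,\theta_R}$; $\bar\theta_x:=\mathbb E_{\mu_{\theta_L,\theta_R}}[\eta(x)/\alpha_x]$. Joint cumulant of random variables $X_1,\dots,X_n$: $\sum_{\gamma}(|\gamma|-1)!\,(-1)^{|\gamma|-1}\prod_{U\in\gamma}\mathbb E\left[\prod_{i\in U}X_i\right]$, the sum running over all set partitions $\gamma$ of $\{1,\dots,n\}$, with $|\gamma|$ the number of blocks. *)

(* Defs.v *)
From HB Require Import structures.
From mathcomp Require Import all_boot all_order all_algebra.
From mathcomp Require Import all_classical all_reals all_analysis.
Set Implicit Arguments.
Unset Strict Implicit.
Unset Printing Implicit Defensive.
Import Order.TTheory GRing.Theory Num.Theory.
Import numFieldNormedType.Exports.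
Local Open Scope classical_set_scope.
Local Open Scope ring_scope.

(* The set of sites V = {1, ..., N} with N >= 1 is encoded as 'I_N.+1 (so the
   number of sites is N.+1); ord0 is the leftmost site and ord_max the
   rightmost one. *)
Record geometry (R : realType) (N : nat) := Geometry {
  omega : 'I_N.+1 -> 'I_N.+1 -> R ;
  alpha : 'I_N.+1 -> nat ;
  omegaL : R ;
  omegaR : R ;
  alphaL : R ;
  alphaR : R ;
  omega_ge0 : forall x y, 0 <= omega x y ;
  omega_sym : forall x y, omega x y = omega y x ;
  omega_diag : forall x, omega x x = 0 ;
  omega_connected :
    forall x y, connect (fun u v : 'I_N.+1 => omega u v != 0) x y ;
  alpha_gt0 : forall x, (0 < alpha x)%N ;
  omegaL_ge0 : 0 <= omegaL ;
  omegaR_ge0 : 0 <= omegaR ;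
  alphaL_gt0 : 0 < alphaL ;
  alphaR_gt0 : 0 < alphaR
}.

Definition Theta (R : realType) (sigma : int) : set R :=
  if sigma == -1 then `[0, 1]%classic else `[0, +oo[%classic.
Arguments Theta R sigma : clear implicits.

Section Configurations.
Context (R : realType) (N : nat) (sigma : int) (G : geometry R N).

Definition admissible (eta : {ffun 'I_N.+1 -> nat}) : bool :=
  (sigma == -1) ==> [forall x, (eta x <= alpha G x)%N].

Record config := Config {
  occupation :> {ffun 'I_N.+1 -> nat} ;
  occupationP : admissible occupation
}.

HB.instance Definition _ := [isSub for occupation].
HB.instance Definition _ := [Countable of config by <:].

Lemma admissible0 : admissible [ffun=> 0%N].
Proof. by apply/implyP => _; apply/forallP => x; rewrite ffunE. Qed.

HB.instance Definition _ := isPointed.Build config (Config admissible0).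

HB.instance Definition _ := @isMeasurable.Build default_measure_display
  config discrete_measurable discrete_measurable0
  discrete_measurableC discrete_measurableU.

(* The three moves below return eta itself when the target is not admissible,
   and use truncated subtraction on empty sites; in the generator all these
   cases come with a vanishing rate. *)

(* eta - delta_x + delta_y, for x != y *)
Definition jump (x y : 'I_N.+1) (eta : config) : config :=
  insubd eta [ffun z => (eta z - (z == x) + (z == y))%N].

(* eta - delta_x *)
Definition kill (x : 'I_N.+1) (eta : config) : config :=
  insubd eta [ffun z => (eta z - (z == x))%N].

(* eta + delta_x *)
Definition create (x : 'I_N.+1) (eta : config) : config :=
  insubd eta [ffun z => (eta z + (z == x))%N].

Let s : R := sigma%:~R.

Definition gen_edge (x y : 'I_N.+1) (f : config -> R) (eta : config) : R :=
  (eta x)%:R * ((alpha G y)%:R + s * (eta y)%:R) * (f (jump x y eta) - f eta)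
  + (eta y)%:R * ((alpha G x)%:R + s * (eta x)%:R)
    * (f (jump y x eta) - f eta).

Definition gen_boundary (a theta : R) (x : 'I_N.+1) (f : config -> R)
    (eta : config) : R :=
  (eta x)%:R * (a * (1 + s * theta)) * (f (kill x eta) - f eta)
  + a * theta * ((alpha G x)%:R + s * (eta x)%:R) * (f (create x eta) - f eta).

Definition generator (thetaL thetaR : R) (f : config -> R) (eta : config) : R :=
  \sum_(p : 'I_N.+1 * 'I_N.+1 | (p.1 < p.2)%N && (omega G p.1 p.2 != 0))
     omega G p.1 p.2 * gen_edge p.1 p.2 f eta
  + omegaL G * gen_boundary (alphaL G) thetaL ord0 f eta
  + omegaR G * gen_boundary (alphaR G) thetaR ord_max f eta.

End Configurations.

Section MarkovSemigroups.
Context d (R : realType) (X : measurableType d).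
Local Open Scope ereal_scope.

(* P t eta is the law at time t >= 0 of the process started from eta (values
   at negative times are irrelevant).  The state spaces used here carry the
   discrete sigma-algebra, so measurability in eta is automatic. *)
Definition markov_semigroup (P : R -> X -> probability X R) : Prop :=
  (forall eta (A : set X), measurable A -> P 0%R eta A = \d_eta A) /\
  (forall (t u : R) eta (A : set X), (0 <= t)%R -> (0 <= u)%R ->
     measurable A ->
     P (t + u)%R eta A = \int[P t eta]_zeta P u zeta A).

(* L f = lim_(t -> 0+) (P_t f - f) / t, uniformly on the state space, for every
   finitely supported f. For the generators considered here, finitely supported
   functions are mapped to finitely supported functions and the process does
   not explode, so this determines the transition semigroup. *)
Definition has_generator (P : R -> X -> probability X R)
    (L : (X -> R) -> X -> R) : Prop :=
  forall f : X -> R, finite_set [set eta | f eta != 0%R] ->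
  forall e : R, (0 < e)%R ->
  \forall t \near (0%R : R)^'+, forall eta,
    (`| (fine 'E_(P t eta)[f] - f eta) / t - L f eta | <= e)%R.

Definition stationary (P : R -> X -> probability X R) (mu : probability X R) :
    Prop :=
  forall (t : R) (A : set X), (0 <= t)%R -> measurable A ->
    \int[mu]_eta P t eta A = mu A.

(* Valued in the extended reals, like the expectations it is built from. *)
Definition joint_cumulant (mu : probability X R) (n : nat)
    (Y : 'I_n -> X -> R) : \bar R :=
  \sum_(gamma : {set {set 'I_n}} | finset.partition gamma [set: 'I_n]%SET)
    ((#|gamma|.-1)`!%:R * (-1) ^+ #|gamma|.-1)%R%:E *
    \prod_(U in gamma) 'E_mu[fun w => (\prod_(i in U) Y i w)%R].

End MarkovSemigroups.

Section Profile.
Context (R : realType) (N : nat) (sigma : int) (G : geometry R N).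

Definition density (x : 'I_N.+1) (eta : config sigma G) : R :=
  (eta x)%:R / (alpha G x)%:R.

Definition thetabar (mu : probability (config sigma G) R) (x : 'I_N.+1) : R :=
  fine 'E_mu[density x]%E.

End Profile.

(* delta_{x_1} + ... + delta_{x_n} *)
Definition sum_delta (N n : nat) (x : 'I_n -> 'I_N.+1) :
    {ffun 'I_N.+1 -> nat} :=
  [ffun y => (\sum_(i < n) (y == x i))%N].

(* Main.v *)
(* The proof runs through self-duality. For a parameter c let q_k be the k-th
   Krawtchouk, Charlier or Meixner polynomial (sigma = -1, 0, 1) attached to
   density c, normalised so that q_0 = 1 and, after division by the rising
   factorial, q_1(eta) = eta/alpha - c. The products
   D^c(xi, eta) of these polynomials intertwine the generator with a
   mass-preserving jump process in xi, killed at the reservoirs, plus a term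
   (theta_L - c), (theta_R - c) times injection from configurations with one
   particle less. With c = theta_R the stationary expectations w(xi) of
   D^c(xi, .) solve a triangular linear system depending on the thetas only
   through theta_L - theta_R; the minimum principle makes the solution unique,
   so w(xi) = (theta_L - theta_R)^|xi| psi(xi). For distinct sites D^c is the
   product of the densities minus theta_R, whence all centred moments, and then
   the cumulants, are homogeneous in theta_L - theta_R.
   The stationary measure is only known to annihilate generators of finitely
   supported functions; on the infinite state spaces finiteness of moments is
   obtained from Lyapunov functions that are combinations of the D^0(xi, .). *)
Require Import Defs.
From HB Require Import structures.
From mathcomp Require Import all_boot all_order all_algebra.
From mathcomp Require Import all_classical all_reals all_analysis.
From mathcomp Require Import ring lra zify.
Set Implicit Arguments.
Unset Strict Implicit.
Unset Printing Implicit Defensive.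
Import Order.TTheory GRing.Theory Num.Theory.
Import numFieldNormedType.Exports.
Local Open Scope classical_set_scope.
Local Open Scope ring_scope.

(** * Single-site polynomials *)

Section SinglesitePolynomials.
Context (R : comNzRingType) (s c al : R).

(* Orthogonal polynomials for the equilibrium of density c; for c = 0 these are
   the falling factorials. The raising part, the diagonal part and [lowered]
   span a representation of the su(2), Heisenberg or su(1,1) algebra, in which
   the identities below express annihilation, creation and occupation. *)
Fixpoint opoly (k : nat) (a : R) : R :=
  if k is j.+1 then
    (a - (c * al + (1 + 2 * s * c) * j%:R)) * opoly j a
    - (if j is i.+1
       then c * (1 + s * c) * (j%:R * (al + s * i%:R) * opoly i a) else 0)
  else 1.

Definition lowered (k : nat) (a : R) : R :=
  k%:R * (al + s * k.-1%:R) * opoly k.-1 a.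

(** The factor k in [lowered] vanishes at k = 0, so the recursion takes the same form at every
    degree. *)
Lemma opolyS k a : opoly k.+1 a =
  (a - (c * al + (1 + 2 * s * c) * k%:R)) * opoly k a
  - c * (1 + s * c) * lowered k a.
Proof. by case: k => [|k] //; rewrite /lowered mul0r mul0r mulr0. Qed.

Lemma opoly_occupation k a : a * opoly k a =
  opoly k.+1 a + (c * (al + 2 * s * k%:R) + k%:R) * opoly k a
  + (s * c ^+ 2 + c) * lowered k a.
Proof. rewrite opolyS; ring. Qed.

Lemma opoly_annihilate k a : a * opoly k (a - 1) =
  opoly k.+1 a + c * (al + 2 * s * k%:R) * opoly k a
  + s * c ^+ 2 * lowered k a.
Proof.
(* The recursion reaches back two degrees, so degrees k and k + 1 are carried through the induction
   together. *)
suff [//] : a * opoly k (a - 1) =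
    opoly k.+1 a + c * (al + 2 * s * k%:R) * opoly k a
    + s * c ^+ 2 * lowered k a /\
  a * opoly k.+1 (a - 1) =
    opoly k.+2 a + c * (al + 2 * s * k.+1%:R) * opoly k.+1 a
    + s * c ^+ 2 * lowered k.+1 a.
elim: k => [|k [IH0 IH1]]; first by rewrite /lowered /=; split; ring.
split => //.
rewrite [opoly k.+2 _]opolyS mulrBr mulrCA IH1.
have -> : a * (c * (1 + s * c) * lowered k.+1 (a - 1)) =
  c * (1 + s * c) * (k.+1%:R * (al + s * k%:R)) * (a * opoly k (a - 1)).
  by rewrite /lowered /=; ring.
rewrite IH0 (opolyS k.+2) (opolyS k.+1) /lowered /=.
rewrite -/(opoly k.+1 a) (opolyS k) /lowered.
set X := k%:R * _ * _; set q := opoly k a.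
ring.
Qed.

Lemma opoly_create k a : (al + s * a) * opoly k (a + 1) =
  s * opoly k.+1 a + (1 + s * c) * (al + 2 * s * k%:R) * opoly k a
  + (1 + s * c) ^+ 2 * lowered k a.
Proof.
suff [//] : (al + s * a) * opoly k (a + 1) =
    s * opoly k.+1 a + (1 + s * c) * (al + 2 * s * k%:R) * opoly k a
    + (1 + s * c) ^+ 2 * lowered k a /\
  (al + s * a) * opoly k.+1 (a + 1) =
    s * opoly k.+2 a + (1 + s * c) * (al + 2 * s * k.+1%:R) * opoly k.+1 a
    + (1 + s * c) ^+ 2 * lowered k.+1 a.
elim: k => [|k [IH0 IH1]]; first by rewrite /lowered /=; split; ring.
split => //.
rewrite [opoly k.+2 _]opolyS mulrBr mulrCA IH1.
have -> : (al + s * a) * (c * (1 + s * c) * lowered k.+1 (a + 1)) =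
  c * (1 + s * c) * (k.+1%:R * (al + s * k%:R))
  * ((al + s * a) * opoly k (a + 1)).
  by rewrite /lowered /=; ring.
rewrite IH0 (opolyS k.+2) (opolyS k.+1) /lowered /=.
rewrite -/(opoly k.+1 a) (opolyS k) /lowered.
set X := k%:R * _ * _; set q := opoly k a.
ring.
Qed.

End SinglesitePolynomials.

(* The (al + 1)-st Krawtchouk polynomial vanishes on {0, ..., al}: at this
   degree the annihilation identity has no lower-order term and becomes the
   first-order recursion [a q(a - 1) = (a - al - 1) q(a)]. *)
Lemma opoly_full (R : numFieldType) (c : R) (al a : nat) : (a <= al)%N ->
  opoly (-1) c al%:R al.+1 a%:R = 0.
Proof.
have low0 (b : R) : lowered (-1) c al%:R al.+1 b = 0.
  by rewrite /lowered /=; ring.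
have rec (b : R) : b * opoly (-1) c al%:R al.+1 (b - 1) =
    (b - al.+1%:R) * opoly (-1) c al%:R al.+1 b.
  by rewrite opoly_annihilate opolyS low0; ring.
elim: a => [|a IH] le_a.
  have := rec 0; rewrite mul0r sub0r mulNr => /esym/eqP.
  by rewrite oppr_eq0 mulf_eq0 pnatr_eq0 /= => /eqP.
have := rec a.+1%:R; rewrite -natr1 addrK (IH (ltnW le_a)) mulr0 => /esym/eqP.
rewrite mulf_eq0 natr1 subr_eq0 eqr_nat => /orP[/eqP e|/eqP //].
by move: le_a; rewrite e ltnn.
Qed.

(** * Action of one edge and of one reservoir on the polynomials *)

Section Edge.
Context (R : comNzRingType) (s c ax ay : R).

(** The edge generator is bilinear in annihilation, creation and occupation at the two sites. Once
    the three expansions are inserted, every term with c in its coefficient cancels; the dual jump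
    structure that remains is the same for all c. *)
Lemma opoly_edge (k l : nat) (a b : R) :
  a * (ay + s * b) * (opoly s c ax k (a - 1) * opoly s c ay l (b + 1)
                      - opoly s c ax k a * opoly s c ay l b)
  + b * (ax + s * a) * (opoly s c ax k (a + 1) * opoly s c ay l (b - 1)
                      - opoly s c ax k a * opoly s c ay l b) =
  lowered s c ax k a * opoly s c ay l.+1 b
  + opoly s c ax k.+1 a * lowered s c ay l b
  - (k%:R * (ay + s * l%:R) + l%:R * (ax + s * k%:R))
    * (opoly s c ax k a * opoly s c ay l b).
Proof.
have Ax := opoly_annihilate s c ax k a; have Ay := opoly_annihilate s c ay l b.
have Cx := opoly_create s c ax k a; have Cy := opoly_create s c ay l b.
have Ox := opoly_occupation s c ax k a; have Oy := opoly_occupation s c ay l b.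
transitivity
  ((a * opoly s c ax k (a - 1)) * ((ay + s * b) * opoly s c ay l (b + 1))
   + ((ax + s * a) * opoly s c ax k (a + 1)) * (b * opoly s c ay l (b - 1))
   - (a * opoly s c ax k a)
     * (ay * opoly s c ay l b + s * (b * opoly s c ay l b))
   - (b * opoly s c ay l b)
     * (ax * opoly s c ax k a + s * (a * opoly s c ax k a))); first by ring.
rewrite Ax Ay Cx Cy Ox Oy.
move: (opoly s c ax k a) (opoly s c ax k.+1 a) (lowered s c ax k a).
move: (opoly s c ay l b) (opoly s c ay l.+1 b) (lowered s c ay l b).
move=> *; ring.
Qed.

(** At c = th the polynomials diagonalise the reservoir. A mismatch th - c only adds a lowering
    term, which is the origin of the injection in the dual equations. *)
Lemma opoly_reservoir (th : R) (k : nat) (a : R) :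
  a * (1 + s * th) * (opoly s c ax k (a - 1) - opoly s c ax k a)
  + th * (ax + s * a) * (opoly s c ax k (a + 1) - opoly s c ax k a) =
  (th - c) * lowered s c ax k a - k%:R * opoly s c ax k a.
Proof.
have A := opoly_annihilate s c ax k a; have C := opoly_create s c ax k a.
have O := opoly_occupation s c ax k a.
transitivity
  ((1 + s * th) * (a * opoly s c ax k (a - 1) - a * opoly s c ax k a)
   + th * ((ax + s * a) * opoly s c ax k (a + 1)
     - (ax * opoly s c ax k a + s * (a * opoly s c ax k a)))); first by ring.
rewrite A C O.
move: (opoly s c ax k a) (opoly s c ax k.+1 a) (lowered s c ax k a).
move=> *; ring.
Qed.

End Edge.

(** * The dual process *)

Lemma min_seq (R : realDomainType) (T : eqType) (u : T -> R) (r : seq T) t :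
  t \in r -> exists2 m, m \in r & forall z, z \in r -> u m <= u z.
Proof.
elim: r t => [//|a [|b r] IH] t _.
  by exists a; rewrite ?mem_head // => z; rewrite inE => /eqP ->.
have [m mr minm] := IH b (mem_head _ _).
have [le_am|/ltW le_ma] := lerP (u a) (u m).
  exists a; first exact: mem_head.
  by move=> z; rewrite inE => /predU1P[->//|/minm]; exact: le_trans.
exists m; first by rewrite inE mr orbT.
by move=> z; rewrite inE => /predU1P[->//|/minm].
Qed.

(** * Configurations of dual particles, graded by mass *)

Section Particles.
Context (N : nat).
Implicit Types xi : {ffun 'I_N.+1 -> nat}.

Definition mass xi : nat := (\sum_x xi x)%N.

Definition move (x y : 'I_N.+1) xi : {ffun 'I_N.+1 -> nat} :=
  [ffun z => (xi z - (z == x) + (z == y))%N].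

Definition remove (x : 'I_N.+1) xi : {ffun 'I_N.+1 -> nat} :=
  [ffun z => (xi z - (z == x))%N].

Lemma mass_remove x xi : (0 < xi x)%N -> (mass (remove x xi)).+1 = mass xi.
Proof.
move=> xi0; rewrite /mass (bigD1 x) //= [in RHS](bigD1 x) //= ffunE eqxx.
rewrite -addSn subn1 prednK //; congr (_ + _)%N.
by apply: eq_bigr => z /negPf zx; rewrite ffunE zx subn0.
Qed.

Lemma mass_move x y xi : (0 < xi x)%N -> mass (move x y xi) = mass xi.
Proof.
move=> xi0; rewrite -(mass_remove xi0) /mass.
transitivity (\sum_z (remove x xi z + (z == y)))%N.
  by apply: eq_bigr => z _; rewrite !ffunE.
have -> : (\sum_z (remove x xi z + (z == y)) =
    \sum_z remove x xi z + \sum_z (z == y))%N by rewrite big_split.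
have -> : (\sum_z (z == y) = 1)%N.
  by rewrite (bigD1 y) //= eqxx big1 // => z /negPf ->.
by rewrite addn1.
Qed.

(** No site holds more than n of the n particles, so the level is finite and can be enumerated
    through functions into ['I_n.+1]. *)
Definition level (n : nat) : seq {ffun 'I_N.+1 -> nat} :=
  [seq xi <- [seq [ffun x => nat_of_ord (f x)]
             | f : {ffun 'I_N.+1 -> 'I_n.+1} <-
                     enum {: {ffun 'I_N.+1 -> 'I_n.+1}}] | mass xi == n].

Lemma mem_level n xi : (xi \in level n) = (mass xi == n).
Proof.
rewrite mem_filter andb_idr // => /eqP xin; apply/mapP.
exists [ffun x => inord (xi x)]; first by rewrite mem_enum.
apply/ffunP => x; rewrite !ffunE inordK // ltnS -xin /mass.
by rewrite (bigD1 x) //= leq_addr.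
Qed.

End Particles.

(** * The dual generator, its minimum principle and the triangular system *)

Section Dual.
Context (R : realType) (N : nat) (sigma : int) (G : geometry R N).

Local Notation V := 'I_N.+1.
Local Notation conf := {ffun V -> nat}.
Local Notation s := (sigma%:~R : R).
Local Notation adm := (admissible sigma G).
Implicit Types (xi : conf) (g : conf -> R).

Lemma admissibleP xi :
  reflect (sigma = -1 -> forall x, (xi x <= alpha G x)%N) (adm xi).
Proof.
apply: (iffP implyP) => [h /eqP/h/forallP //|h /eqP e].
by apply/forallP; exact: h.
Qed.

(** Symmetry of the conductances merges the two orientations of an edge; diagonal pairs and
    non-edges have conductance zero. *)
Lemma pair_sumE (A : V -> V -> R) :
  \sum_(p : V * V | (p.1 < p.2)%N && (omega G p.1 p.2 != 0))
     omega G p.1 p.2 * (A p.1 p.2 + A p.2 p.1)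
  = \sum_(p : V * V) omega G p.1 p.2 * A p.1 p.2.
Proof.
transitivity (\sum_(p : V * V | (p.1 < p.2)%N)
   (omega G p.1 p.2 * A p.1 p.2 + omega G p.2 p.1 * A p.2 p.1)).
  rewrite big_mkcondr; apply: eq_bigr => p _; case: eqP => [e|_] /=.
    by rewrite (omega_sym G p.2) e !mul0r addr0.
  by rewrite (omega_sym G p.2) mulrDr.
rewrite big_split /= [RHS](bigID (fun p : V * V => (p.1 < p.2)%N)) /=.
congr (_ + _); rewrite [RHS](bigID (fun p : V * V => (p.2 < p.1)%N)) /=.
rewrite [X in _ = _ + X]big1 ?addr0 => [|[x y] /=]; last first.
  rewrite -!leqNgt -eqn_leq => /eqP/ord_inj ->.
  by rewrite omega_diag mul0r.
rewrite (reindex_inj (h := fun p : V * V => (p.2, p.1))) /=; last first.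
  by move=> [a b] [c d] [-> ->].
apply: eq_bigl => -[x y] /=; rewrite andb_idl // => lt_yx.
by rewrite -leqNgt ltnW.
Qed.

Definition hop_rate xi (x y : V) : R :=
  (xi x)%:R * ((alpha G y)%:R + s * (xi y)%:R).

Definition killing xi : R :=
  omegaL G * alphaL G * (xi ord0)%:R + omegaR G * alphaR G * (xi ord_max)%:R.

Definition dual_generator g xi : R :=
  \sum_(p : V * V | (p.1 < p.2)%N && (omega G p.1 p.2 != 0))
     omega G p.1 p.2 * (hop_rate xi p.1 p.2 * (g (move p.1 p.2 xi) - g xi)
                        + hop_rate xi p.2 p.1 * (g (move p.2 p.1 xi) - g xi))
  - killing xi * g xi.

Definition injection (tL tR : R) g xi : R :=
  tL * (omegaL G * alphaL G * (xi ord0)%:R * g (remove ord0 xi))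
  + tR * (omegaR G * alphaR G * (xi ord_max)%:R * g (remove ord_max xi)).

Lemma dual_generatorE g xi : dual_generator g xi =
  \sum_(p : V * V) omega G p.1 p.2
     * (hop_rate xi p.1 p.2 * (g (move p.1 p.2 xi) - g xi)) - killing xi * g xi.
Proof.
rewrite /dual_generator; congr (_ - _).
exact: (pair_sumE (fun x y => hop_rate xi x y * (g (move x y xi) - g xi))).
Qed.

(** For sigma = -1 a full target site makes the rate zero, so a nonzero rate never overfills a
    site. *)
Lemma move_admissible xi x y : adm xi -> x != y -> hop_rate xi x y != 0 ->
  adm (move x y xi).
Proof.
move=> /admissibleP h xy r0; apply/admissibleP => e z; rewrite ffunE.
have := h e z; have [->|zy] := eqVneq z y; last by lia.
rewrite eq_sym (negPf xy) subn0 leq_eqVlt => /predU1P[ez|]; last by lia.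
by move: r0; rewrite /hop_rate e mulrN1z ez mulN1r subrr mulr0 eqxx.
Qed.

Lemma remove_admissible xi x : adm xi -> adm (remove x xi).
Proof.
move=> /admissibleP h; apply/admissibleP => e z; rewrite ffunE.
exact: leq_trans (leq_subr _ _) (h e z).
Qed.

Context (hsigma : sigma \in [:: -1; 0; 1]).

Lemma sigmaP : [\/ sigma = -1, sigma = 0 | sigma = 1].
Proof.
by move: hsigma; rewrite !inE => /or3P[] /eqP ->;
  [constructor 1|constructor 2|constructor 3].
Qed.

Lemma slope_ge0 (k a : nat) : (sigma = -1 -> (k <= a)%N) ->
  0 <= a%:R + s * k%:R.
Proof.
case: sigmaP => -> h.
- by rewrite mulrN1z mulN1r subr_ge0 ler_nat h.
- by rewrite mulr0z mul0r addr0.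
- by rewrite mul1r addr_ge0.
Qed.

Lemma rate_ge0 xi x y : adm xi -> 0 <= hop_rate xi x y.
Proof.
by move=> /admissibleP h; rewrite mulr_ge0 // slope_ge0 // => /h.
Qed.

Lemma killing_ge0 xi : 0 <= killing xi.
Proof.
by rewrite addr_ge0 // !mulr_ge0 ?omegaL_ge0 ?omegaR_ge0 // ltW
  ?alphaL_gt0 ?alphaR_gt0.
Qed.

(** A site where particles are really killed: if the left reservoir is switched off, the right one
    must be active. *)
Definition reservoir_site : V := if omegaL G > 0 then ord0 else ord_max.

Context (hG : 0 < Num.max (omegaL G) (omegaR G)).

Lemma killing_gt0 xi : (0 < xi reservoir_site)%N -> 0 < killing xi.
Proof.
rewrite /reservoir_site /killing; case: ifPn => [wL xi0|wL xi0].
  rewrite ltr_pwDl // ?mulr_gt0 ?ltr0n ?alphaL_gt0 //.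
  by rewrite !mulr_ge0 ?omegaR_ge0 // ltW ?alphaR_gt0.
have wR : 0 < omegaR G by move: hG; rewrite lt_max (negPf wL).
rewrite ltr_wpDl // ?mulr_gt0 ?ltr0n ?alphaR_gt0 //.
by rewrite !mulr_ge0 ?omegaL_ge0 // ltW ?alphaL_gt0.
Qed.

(* At a negative minimum all jump terms and the killing term are nonnegative,
   hence all vanish: the minimum propagates along every possible jump. A
   particle can be brought to the reservoir along a path, either by jumping to
   the next site of the path if it is empty, or by considering instead the particle
   already sitting there; at the reservoir the killing term is positive. *)
Lemma minimum_principle (n : nat) (u : conf -> R) : (0 < n)%N ->
  (forall xi, adm xi -> mass xi = n -> dual_generator u xi <= 0) ->
  forall xi, adm xi -> mass xi = n -> 0 <= u xi.
Proof.
move=> n0 super xi0 adm0 mass0; rewrite leNgt; apply/negP => u0.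
have /(min_seq u)[m] : xi0 \in [seq xi <- level N n | adm xi].
  by rewrite mem_filter mem_level mass0 eqxx adm0.
rewrite mem_filter mem_level => /andP[adm_m /eqP mass_m] min_m.
have {min_m} min_m xi : adm xi -> mass xi = n -> u m <= u xi.
  by move=> a e; apply: min_m; rewrite mem_filter mem_level a e eqxx.
have um0 : u m < 0 by exact: le_lt_trans (min_m _ adm0 mass0) u0.
have jump_ge0 xi x y : adm xi -> mass xi = n -> u xi = u m ->
    0 <= omega G x y * (hop_rate xi x y * (u (move x y xi) - u xi)).
  move=> ax mx ux; have [->|xy] := eqVneq x y.
    by rewrite omega_diag mul0r.
  have [->|r0] := eqVneq (hop_rate xi x y) 0; first by rewrite mul0r mulr0.
  rewrite mulr_ge0 ?omega_ge0 // mulr_ge0 ?rate_ge0 // subr_ge0 ux min_m //.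
    exact: move_admissible.
  rewrite mass_move // lt0n; apply: contraNneq r0 => e.
  by rewrite /hop_rate e mul0r.
have stuck xi x : adm xi -> mass xi = n -> u xi = u m -> (0 < xi x)%N ->
    forall p, path (fun a b : V => omega G a b != 0) x p ->
    last x p = reservoir_site -> False.
  move=> + + + + p; elim: p x xi => [|y p IH] x xi ax mx ux xi_x /=.
    move=> _ xb; have := super xi ax mx; rewrite leNgt => /negP; apply.
    rewrite dual_generatorE ltr_wpDl //.
      by apply: sumr_ge0 => -[a b] _; exact: jump_ge0.
    by rewrite oppr_gt0 ux pmulr_rlt0 // killing_gt0 // -xb.
  move=> /andP[wxy yp] lastp.
  have [y0|y0] := posnP (xi y); last exact: (IH y xi).
  have xy : x != y by apply: contraNneq wxy => ->; rewrite omega_diag.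
  have r0 : 0 < hop_rate xi x y.
    by rewrite /hop_rate y0 mulr0 addr0 mulr_gt0 ?ltr0n ?alpha_gt0.
  have adm' : adm (move x y xi).
    by apply: move_admissible => //; rewrite gt_eqF.
  have mass' : mass (move x y xi) = n by rewrite mass_move.
  apply: (IH y (move x y xi)) => //; last first.
    by rewrite ffunE eqxx addn1.
  apply/eqP; rewrite eq_le min_m // andbT -ux -subr_le0.
  have wr0 : 0 < omega G x y * hop_rate xi x y.
    by rewrite mulr_gt0 // lt_def wxy omega_ge0.
  rewrite -(pmulr_rle0 _ wr0) -mulrA.
  apply: le_trans (super xi ax mx); rewrite dual_generatorE.
  rewrite (bigD1 (x, y)) //= -addrA lerDl addr_ge0 //.
    by apply: sumr_ge0 => -[a b] _; exact: jump_ge0.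
  by rewrite -mulrN mulr_ge0 ?killing_ge0 // oppr_ge0 ux ltW.
have [x mx] : exists x, (0 < m x)%N.
  apply/existsP; move: n0; rewrite -mass_m; apply: contraLR.
  rewrite negb_exists -eqn0Ngt => /forallP h; apply/eqP; apply: big1 => x _.
  by apply/eqP; rewrite -leqn0 leqNgt.
have /connectP[p xp lastp] := omega_connected G x reservoir_site.
exact: (stuck m x adm_m mass_m erefl mx p xp (esym lastp)).
Qed.

Lemma dual_generatorB g1 g2 xi :
  dual_generator (fun z => g1 z - g2 z) xi =
  dual_generator g1 xi - dual_generator g2 xi.
Proof.
rewrite !dual_generatorE.
transitivity (\sum_p (omega G p.1 p.2
     * (hop_rate xi p.1 p.2 * (g1 (move p.1 p.2 xi) - g1 xi)) -
   omega G p.1 p.2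
     * (hop_rate xi p.1 p.2 * (g2 (move p.1 p.2 xi) - g2 xi)))
   - killing xi * (g1 xi - g2 xi)).
  by congr (_ - _); apply: eq_bigr => p _; ring.
rewrite sumrB; ring.
Qed.

(** For c = theta_R only the left reservoir injects, with strength t = theta_L - theta_R; hence the
    0 in [injection]. The value at the empty configuration is the mean of the constant 1. *)
Definition dual_solution (t : R) (w : conf -> R) : Prop :=
  w [ffun=> 0%N] = 1 /\
  forall xi, adm xi -> (0 < mass xi)%N ->
    dual_generator w xi + injection t 0 w xi = 0.

Lemma mass0 xi : mass xi = 0%N -> xi = [ffun=> 0%N].
Proof.
move=> /eqP; rewrite /mass sum_nat_eq0 => /forallP h.
by apply/ffunP => x; rewrite ffunE; apply/eqP; exact: h.
Qed.

(** Induction on the mass. Injection reads only the level below, so the difference of two solutions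
    is annihilated by the dual generator on the current level; the minimum principle, applied to
    both orders of subtraction, makes it vanish. *)
Lemma dual_solution_unique t w1 w2 :
  dual_solution t w1 -> dual_solution t w2 ->
  forall xi, adm xi -> w1 xi = w2 xi.
Proof.
move=> [w10 h1] [w20 h2] xi.
have [n] := ubnP (mass xi); elim: n xi => // n IH xi; rewrite ltnS leq_eqVlt.
move=> /predU1P[mx ax|]; last exact: IH.
have [n0|n0] := posnP n; first by rewrite (@mass0 xi) ?w10 ?w20 // mx.
suff h (w w' : conf -> R) : dual_solution t w -> dual_solution t w' ->
    (forall z, adm z -> (mass z < n)%N -> w z = w' z) -> 0 <= w xi - w' xi.
  apply/eqP; rewrite eq_le -subr_ge0 h //=.
    by rewrite -subr_ge0 h // => z az mz; exact: IH.
  by move=> z az mz; rewrite IH.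
move=> [_ hw] [_ hw'] eqw.
apply: (@minimum_principle n (fun z => w z - w' z)) => // z az mz.
have {}hw := hw z az; have {}hw' := hw' z az.
rewrite mz in hw hw'; have {}hw := hw n0; have {}hw' := hw' n0.
suff e : injection t 0 w z = injection t 0 w' z.
  rewrite dual_generatorB; move/eqP: hw; rewrite e addr_eq0 => /eqP ->.
  by move/eqP: hw'; rewrite addr_eq0 => /eqP ->; rewrite subrr.
rewrite /injection !mul0r !addr0; congr (_ * _).
have [->|z0] := posnP (z ord0); first by rewrite !mulr0 !mul0r.
by rewrite eqw // ?remove_admissible // -mz -(mass_remove z0).
Qed.

(** Jumps preserve the mass and injection lowers it by one; the missing factor r is absorbed into
    t. *)
Lemma dual_solution_scale t r w : dual_solution t w ->
  dual_solution (r * t) (fun z => r ^+ mass z * w z).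
Proof.
move=> [w0 h]; split.
  by rewrite w0 mulr1 /mass big1 // => x _; rewrite ffunE.
move=> xi ax mx; have := h xi ax mx => /(congr1 ( *%R (r ^+ mass xi))).
rewrite mulr0 => e; apply: etrans e; rewrite mulrDr; congr (_ + _).
  rewrite !dual_generatorE mulrBr mulrCA; congr (_ - _).
  rewrite mulr_sumr; apply: eq_bigr => -[x y] _ /=.
  have [r0|r0] := eqVneq (hop_rate xi x y) 0; first by rewrite r0; ring.
  rewrite mass_move; first by ring.
  by rewrite lt0n; apply: contraNneq r0 => e; rewrite /hop_rate e mul0r.
rewrite /injection !mul0r !addr0.
have [->|x0] := posnP (xi ord0); first by ring.
by rewrite -(mass_remove x0) exprS; ring.
Qed.

(** Scaling a solution for t = 1 gives one for every t, and uniqueness identifies it with w. A case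
    distinction on whether t = 1 is solvable avoids constructing a solution. *)
Lemma dual_solution_homogeneous : exists psi : conf -> R,
  forall t w, dual_solution t w ->
  forall xi, adm xi -> w xi = t ^+ mass xi * psi xi.
Proof.
have [[w1 sol1]|nsol] := pselect (exists w1, dual_solution 1 w1).
  exists w1 => t w sol; have := dual_solution_scale t sol1; rewrite mulr1.
  exact: dual_solution_unique.
(* If t = 1 has no solution, scaling by the inverse rules out every nonzero t. At t = 0 nothing is
   injected and the indicator of the empty configuration is the solution. *)
exists (fun xi => (mass xi == 0%N)%:R) => t w sol xi ax.
have [t0|t0] := eqVneq t 0; last first.
  case: nsol; exists (fun z => t^-1 ^+ mass z * w z).
  by have := dual_solution_scale t^-1 sol; rewrite mulVf.
suff h : dual_solution t (fun z => t ^+ mass z * (mass z == 0)%:R).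
  exact: (dual_solution_unique sol h).
have m0 : mass ([ffun=> 0%N] : conf) = 0%N.
  by rewrite /mass big1 // => x _; rewrite ffunE.
split; first by rewrite m0 mulr1.
move=> z az mz; rewrite /injection t0 !mul0r !addr0 dual_generatorE.
rewrite (gtn_eqF mz) mulr0 mulr0 subr0 big1 // => -[x y] _ /=.
have [r0|r0] := eqVneq (hop_rate z x y) 0; first by rewrite r0 mul0r mulr0.
rewrite mass_move ?(gtn_eqF mz) ?mulr0 ?subrr ?mulr0 //.
by rewrite lt0n; apply: contraNneq r0 => e; rewrite /hop_rate e mul0r.
Qed.

End Dual.

(** * Duality *)

Section Duality.
Context (R : realType) (N : nat) (sigma : int) (G : geometry R N).
Context (hsigma : sigma \in [:: -1; 0; 1]).

Local Notation V := 'I_N.+1.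
Local Notation conf := {ffun V -> nat}.
Local Notation config := (config sigma G).
Local Notation s := (sigma%:~R : R).
Local Notation adm := (admissible sigma G).
Local Notation rate := (hop_rate sigma G).
Implicit Types (xi : conf) (eta : config) (f : config -> R).

(** One finite index type for all transitions: [inl (x, y)] is the jump from x to y; in [inr (b, d)]
    the bit b selects the left reservoir and d selects removal. The generator becomes a single sum
    of rates times increments, the form used in the drift and domination estimates. *)
Definition transition_rate (tL tR : R) (i : V * V + bool * bool) eta : R :=
  match i with
  | inl (x, y) => omega G x y * rate eta x y
  | inr (true, true) =>
      omegaL G * ((eta ord0)%:R * (alphaL G * (1 + s * tL)))
  | inr (true, false) =>
      omegaL G * (alphaL G * tL * ((alpha G ord0)%:R + s * (eta ord0)%:R))
  | inr (false, true) =>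
      omegaR G * ((eta ord_max)%:R * (alphaR G * (1 + s * tR)))
  | inr (false, false) =>
      omegaR G
      * (alphaR G * tR * ((alpha G ord_max)%:R + s * (eta ord_max)%:R))
  end.

Definition transition (i : V * V + bool * bool) eta : config :=
  match i with
  | inl (x, y) => jump x y eta
  | inr (b, d) =>
      let x := if b then ord0 else ord_max in
      if d then kill x eta else create x eta
  end.

Lemma generatorE tL tR f eta : generator tL tR f eta =
  \sum_i transition_rate tL tR i eta * (f (transition i eta) - f eta).
Proof.
rewrite /generator big_sumType /= -addrA; congr (_ + _).
  rewrite [LHS](pair_sumE G
    (fun x y => rate eta x y * (f (jump x y eta) - f eta))).
  by apply: eq_bigr => -[x y] _ /=; rewrite mulrA.
have sum_bool2 (F : bool * bool -> R) : \sum_p F p =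
    F (true, true) + F (true, false) + (F (false, true) + F (false, false)).
  transitivity (\sum_b \sum_d F (b, d)); last by rewrite !big_bool.
  by rewrite pair_bigA; apply: eq_bigr => -[].
rewrite sum_bool2 /=.
by rewrite /gen_boundary; ring.
Qed.

Lemma generatorZ tL tR (a : R) f eta :
  generator tL tR (fun z => a * f z) eta = a * generator tL tR f eta.
Proof.
by rewrite !generatorE mulr_sumr; apply: eq_bigr => i _; ring.
Qed.

Lemma generatorD tL tR f g eta : generator tL tR (fun z => f z + g z) eta =
  generator tL tR f eta + generator tL tR g eta.
Proof.
by rewrite !generatorE -big_split; apply: eq_bigr => i _ /=; ring.
Qed.

Lemma config_admissible eta : adm eta.
Proof. by case: eta. Qed.

Lemma transition_rate_ge0 tL tR i eta :
  Theta R sigma tL -> Theta R sigma tR -> 0 <= transition_rate tL tR i eta.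
Proof.
have thP t : Theta R sigma t -> 0 <= t /\ 0 <= 1 + s * t.
  rewrite /Theta; case: (sigmaP hsigma) => -> /=; rewrite ?mulrN1z ?mulr0z;
    rewrite in_itv /= => /andP[t0 t1]; split => //; lra.
move=> /thP[L0 L1] /thP[R0 R1].
have a0 x : 0 <= (alpha G x)%:R + s * (eta x)%:R.
  by apply: slope_ge0 => //; have /admissibleP h := config_admissible eta =>
    /h.
case: i => [[x y]|[[] []]] /=.
- by rewrite mulr_ge0 ?omega_ge0 // rate_ge0 // config_admissible.
- by rewrite !mulr_ge0 ?omegaL_ge0 // ltW ?alphaL_gt0.
- by rewrite !mulr_ge0 ?omegaL_ge0 // ltW ?alphaL_gt0.
- by rewrite !mulr_ge0 ?omegaR_ge0 // ltW ?alphaR_gt0.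
- by rewrite !mulr_ge0 ?omegaR_ge0 // ltW ?alphaR_gt0.
Qed.

Definition add (x : V) (xi : conf) : conf := [ffun z => (xi z + (z == x))%N].

(** A nonzero rate makes the target admissible, so [insubd] does not fall back on its default. *)
Lemma jumpE x y eta : x != y -> rate eta x y != 0 ->
  occupation (jump x y eta) = move x y eta.
Proof.
move=> xy r0; suff h : adm (move x y eta) by exact: (insubdK eta h).
exact: (move_admissible (config_admissible eta) xy r0).
Qed.

Lemma killE x eta : occupation (kill x eta) = remove x eta.
Proof.
suff h : adm (remove x eta) by exact: (insubdK eta h).
exact: (remove_admissible x (config_admissible eta)).
Qed.

Lemma createE x eta : (alpha G x)%:R + s * (eta x)%:R != 0 :> R ->
  occupation (create x eta) = add x eta.
Proof.
move=> a0; suff h : adm (add x eta) by exact: (insubdK eta h).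
apply/admissibleP => e z.
have /admissibleP/(_ e z) := config_admissible eta.
rewrite ffunE; have [->|] := eqVneq z x; last by rewrite addn0.
rewrite leq_eqVlt addn1 => /predU1P[ez|//].
by move: a0; rewrite ez e mulrN1z mulN1r subrr eqxx.
Qed.

Definition multi_opoly (c : R) xi (eta : conf) : R :=
  \prod_x opoly s c (alpha G x)%:R (xi x) (eta x)%:R.

Lemma prodD2 (F : V -> R) x y : x != y ->
  \prod_z F z = F x * F y * \prod_(z | (z != x) && (z != y)) F z.
Proof.
by move=> xy; rewrite (bigD1 x) //= (bigD1 y) ?mulrA // eq_sym.
Qed.

(** The coefficient occurring in [lowered], read at one site of a configuration. *)
Definition descent xi x : R :=
  (xi x)%:R * ((alpha G x)%:R + s * (xi x).-1%:R).

Lemma gen_edge_multi_opoly c x y xi eta : x != y ->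
  gen_edge x y (fun z => multi_opoly c xi z) eta =
  descent xi x * multi_opoly c (move x y xi) eta
  + descent xi y * multi_opoly c (move y x xi) eta
  - (rate xi x y + rate xi y x) * multi_opoly c xi eta.
Proof.
move=> xy; have yx : y != x by rewrite eq_sym.
set rest := \prod_(z | (z != x) && (z != y))
  opoly s c (alpha G z)%:R (xi z) (eta z)%:R.
pose o z k (a : R) := opoly s c (alpha G z)%:R k a.
have prodE xi' (eta' : conf) : (forall z, z != x -> z != y -> xi' z = xi z) ->
    (forall z, z != x -> z != y -> eta' z = eta z) ->
    multi_opoly c xi' eta' =
    o x (xi' x) (eta' x)%:R * o y (xi' y) (eta' y)%:R * rest.
  move=> h1 h2; rewrite /multi_opoly (prodD2 _ xy); congr (_ * _).
  by apply: eq_bigr => z /andP[zx zy]; rewrite h1 // h2.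
have off_move (u : conf) a b : forall z, z != a -> z != b -> move a b u z = u z.
  by move=> z /negPf za /negPf zb; rewrite ffunE za zb subn0 addn0.
have off_move' (u : conf) a b :
    forall z, z != b -> z != a -> move a b u z = u z.
  by move=> z zb za; exact: off_move.
(* The rate stays as a factor: where it vanishes, the jump may be a default value or a truncated
   subtraction, but both sides are 0. *)
have Jx : rate eta x y * multi_opoly c xi (jump x y eta) =
    rate eta x y * (o x (xi x) ((eta x)%:R - 1) * o y (xi y) ((eta y)%:R + 1)
                    * rest).
  have [->|r0] := eqVneq (rate eta x y) 0; first by rewrite !mul0r.
  have ex : (0 < eta x)%N.
    by rewrite lt0n; apply: contraNneq r0 => e; rewrite /hop_rate e mul0r.
  rewrite jumpE // (prodE xi) //; last exact: off_move.
  rewrite !ffunE !eqxx (negPf xy) (negPf yx) addn0 subn0 natrB //.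
  by rewrite natrD.
have Jy : rate eta y x * multi_opoly c xi (jump y x eta) =
    rate eta y x * (o x (xi x) ((eta x)%:R + 1) * o y (xi y) ((eta y)%:R - 1)
                    * rest).
  have [->|r0] := eqVneq (rate eta y x) 0; first by rewrite !mul0r.
  have ey : (0 < eta y)%N.
    by rewrite lt0n; apply: contraNneq r0 => e; rewrite /hop_rate e mul0r.
  rewrite jumpE // (prodE xi) //; last exact: off_move'.
  rewrite !ffunE !eqxx (negPf xy) (negPf yx) addn0 subn0 natrB //.
  by rewrite natrD.
rewrite /gen_edge -!/(hop_rate sigma G _ _ _) mulrBr Jx mulrBr Jy.
rewrite (prodE xi eta) // (prodE (move x y xi) eta) //; last exact: off_move.
rewrite (prodE (move y x xi) eta) //; last exact: off_move'.
rewrite !ffunE !eqxx (negPf xy) (negPf yx) !addn0 !subn0 !addn1 !subn1.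
have E := opoly_edge s c (alpha G x)%:R (alpha G y)%:R (xi x) (xi y)
  (eta x)%:R (eta y)%:R.
rewrite /lowered in E.
transitivity (rest *
  ((eta x)%:R * ((alpha G y)%:R + s * (eta y)%:R) *
      (o x (xi x) ((eta x)%:R - 1) * o y (xi y) ((eta y)%:R + 1)
       - o x (xi x) (eta x)%:R * o y (xi y) (eta y)%:R)
  + (eta y)%:R * ((alpha G x)%:R + s * (eta x)%:R) *
      (o x (xi x) ((eta x)%:R + 1) * o y (xi y) ((eta y)%:R - 1)
       - o x (xi x) (eta x)%:R * o y (xi y) (eta y)%:R))).
  by rewrite /hop_rate; ring.
by rewrite E /descent /hop_rate /o; ring.
Qed.

Lemma gen_boundary_multi_opoly c a th x xi eta :
  gen_boundary a th x (fun z => multi_opoly c xi z) eta =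
  a * ((th - c) * descent xi x * multi_opoly c (remove x xi) eta
       - (xi x)%:R * multi_opoly c xi eta).
Proof.
set rest := \prod_(z | z != x) opoly s c (alpha G z)%:R (xi z) (eta z)%:R.
pose o k (b : R) := opoly s c (alpha G x)%:R k b.
have prodE xi' (eta' : conf) : (forall z, z != x -> xi' z = xi z) ->
    (forall z, z != x -> eta' z = eta z) ->
    multi_opoly c xi' eta' = o (xi' x) (eta' x)%:R * rest.
  move=> h1 h2; rewrite /multi_opoly (bigD1 x) //=; congr (_ * _).
  by apply: eq_bigr => z zx; rewrite h1 // h2.
have off_rm (u : conf) z : z != x -> remove x u z = u z.
  by move=> /negPf zx; rewrite ffunE zx subn0.
have off_add (u : conf) z : z != x -> add x u z = u z.
  by move=> /negPf zx; rewrite ffunE zx addn0.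
have K : (eta x)%:R * multi_opoly c xi (kill x eta) =
    (eta x)%:R * (o (xi x) ((eta x)%:R - 1) * rest).
  have [->|ex] := posnP (eta x); first by rewrite !mul0r.
  rewrite killE // (prodE xi) //; last exact: off_rm.
  by rewrite ffunE eqxx natrB.
have C : ((alpha G x)%:R + s * (eta x)%:R) * multi_opoly c xi (create x eta) =
    ((alpha G x)%:R + s * (eta x)%:R) * (o (xi x) ((eta x)%:R + 1) * rest).
  have [->|r0] := eqVneq ((alpha G x)%:R + s * (eta x)%:R) 0.
    by rewrite !mul0r.
  rewrite createE // (prodE xi) //; last exact: off_add.
  by rewrite ffunE eqxx natrD.
have B := opoly_reservoir s c (alpha G x)%:R th (xi x) (eta x)%:R.
rewrite /lowered in B.
rewrite (prodE (remove x xi) eta) //; last exact: off_rm.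
rewrite ffunE eqxx subn1.
transitivity (a * ((1 + s * th) * ((eta x)%:R * multi_opoly c xi (kill x eta)
    - (eta x)%:R * multi_opoly c xi eta)
  + th * (((alpha G x)%:R + s * (eta x)%:R) * multi_opoly c xi (create x eta)
    - ((alpha G x)%:R + s * (eta x)%:R) * multi_opoly c xi eta))).
  by rewrite /gen_boundary; ring.
rewrite K C (prodE xi eta) //.
transitivity (a * rest * ((eta x)%:R * (1 + s * th)
    * (o (xi x) ((eta x)%:R - 1) - o (xi x) (eta x)%:R)
  + th * ((alpha G x)%:R + s * (eta x)%:R)
    * (o (xi x) ((eta x)%:R + 1) - o (xi x) (eta x)%:R))); first by ring.
by rewrite B /descent /o; ring.
Qed.

(* For sigma = -1 the weight vanishes on inadmissible xi, and the dual function
   is then 0 by convention; the corresponding jump rates vanish. *)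
Definition weight xi : R :=
  \prod_x \prod_(j < xi x) ((alpha G x)%:R + s * j%:R).

Definition dual_function c xi (eta : conf) : R :=
  multi_opoly c xi eta / weight xi.

Lemma slope_gt0 (x : V) (j k : nat) : (sigma = -1 -> (k <= alpha G x)%N) ->
  (j < k)%N -> 0 < (alpha G x)%:R + s * j%:R.
Proof.
have a0 := alpha_gt0 G x; case: (sigmaP hsigma) => -> h jk.
- by rewrite mulrN1z mulN1r subr_gt0 ltr_nat (leq_trans jk) ?h.
- by rewrite mulr0z mul0r addr0 ltr0n.
- by rewrite mul1r ltr_pwDl // ltr0n.
Qed.

Lemma weight_gt0 xi : adm xi -> 0 < weight xi.
Proof.
move=> /admissibleP h; apply: prodr_gt0 => x _; apply: prodr_gt0 => j _.
by apply: (@slope_gt0 x j (xi x)) => // /h.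
Qed.

Lemma weight_remove xi x : (0 < xi x)%N ->
  weight (remove x xi) * ((alpha G x)%:R + s * (xi x).-1%:R) = weight xi.
Proof.
move=> x0; rewrite /weight (bigD1 x) //= [in RHS](bigD1 x) //= mulrAC.
congr (_ * _).
  by rewrite ffunE eqxx subn1; case: (xi x) x0 => // k _; rewrite big_ord_recr.
by apply: eq_bigr => z /negPf zx; rewrite ffunE zx subn0.
Qed.

Lemma weight_add xi x :
  weight (add x xi) = weight xi * ((alpha G x)%:R + s * (xi x)%:R).
Proof.
rewrite /weight (bigD1 x) //= [in RHS](bigD1 x) //= mulrAC.
congr (_ * _).
  by rewrite ffunE eqxx addn1 big_ord_recr.
by apply: eq_bigr => z /negPf zx; rewrite ffunE zx addn0.
Qed.

Lemma move_add_remove x y xi : move x y xi = add y (remove x xi).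
Proof. by apply/ffunP => z; rewrite !ffunE. Qed.

Lemma multi_opoly_full c xi x eta : sigma = -1 -> xi x = (alpha G x).+1 ->
  multi_opoly c xi eta = 0.
Proof.
move=> e ex; have es : s = -1 by rewrite e mulrN1z.
rewrite /multi_opoly (bigD1 x) //= ex es opoly_full ?mul0r //.
by have /admissibleP := config_admissible eta; apply.
Qed.

(** Moving a particle changes the weight by the ratio of the slopes at the two sites; this turns the
    polynomial coefficient [descent] into the jump rate of the dual. *)
Lemma descent_dual_function c xi x y eta : adm xi -> x != y ->
  descent xi x * multi_opoly c (move x y xi) eta / weight xi =
  rate xi x y * dual_function c (move x y xi) eta.
Proof.
move=> ax xy; have yx : y != x by rewrite eq_sym.
rewrite /descent /hop_rate /dual_function.
have [->|x0] := posnP (xi x); first by rewrite !mul0r.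
have w0 : weight xi != 0 by rewrite gt_eqF ?weight_gt0.
(* A zero slope forces sigma = -1 and a full target: the moved configuration has degree alpha_y + 1
   at y, where the polynomial vanishes on the state space. *)
have [r0|r0] := eqVneq ((alpha G y)%:R + s * (xi y)%:R) 0.
  rewrite (@multi_opoly_full c (move x y xi) y).
    by rewrite !(mulr0, mul0r).
    case: (sigmaP hsigma) => // e; move: r0; rewrite e.
      rewrite mulr0z mul0r addr0 => /eqP.
      by rewrite pnatr_eq0 gtn_eqF ?alpha_gt0.
    rewrite mul1r -natrD => /eqP; rewrite pnatr_eq0 addn_eq0.
    by rewrite gtn_eqF ?alpha_gt0.
  rewrite ffunE (negPf yx) eqxx subn0 addn1; congr _.+1.
  move: r0; case: (sigmaP hsigma) => ->.
  - by rewrite mulrN1z mulN1r => /eqP; rewrite subr_eq0 eqr_nat => /eqP.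
  - by rewrite mulr0z mul0r addr0 => /eqP; rewrite pnatr_eq0 gtn_eqF ?alpha_gt0.
  - rewrite mul1r -natrD => /eqP; rewrite pnatr_eq0 addn_eq0.
    by rewrite gtn_eqF ?alpha_gt0.
have am : adm (move x y xi).
  apply: move_admissible => //.
  by rewrite /hop_rate mulf_neq0 // pnatr_eq0 -lt0n.
have wm0 : weight (move x y xi) != 0 by rewrite gt_eqF ?weight_gt0.
have E : weight (move x y xi) * ((alpha G x)%:R + s * (xi x).-1%:R) =
    weight xi * ((alpha G y)%:R + s * (xi y)%:R).
  rewrite move_add_remove weight_add mulrAC weight_remove // ffunE.
  by rewrite (negPf yx) subn0.
have -> : (alpha G x)%:R + s * (xi x).-1%:R =
    weight xi * ((alpha G y)%:R + s * (xi y)%:R) / weight (move x y xi).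
  by rewrite -E mulrAC divff // mul1r.
by field; rewrite w0 wm0.
Qed.

Lemma descent_dual_function_remove c xi x eta : adm xi ->
  descent xi x * multi_opoly c (remove x xi) eta / weight xi =
  (xi x)%:R * dual_function c (remove x xi) eta.
Proof.
move=> ax; rewrite /descent /dual_function.
have [->|x0] := posnP (xi x); first by rewrite !mul0r.
have : weight xi != 0 by rewrite gt_eqF ?weight_gt0.
rewrite -(weight_remove x0) mulf_eq0 negb_or => /andP[w0 a0].
by field; rewrite w0 a0.
Qed.

(** Edges contribute the mass-preserving dual jumps. Each reservoir contributes killing and an
    injection proportional to its density minus c. *)
Lemma duality c tL tR xi eta : adm xi ->
  generator tL tR (fun z => dual_function c xi z) eta =
  dual_generator sigma G (dual_function c ^~ eta) xi
  + injection G (tL - c) (tR - c) (dual_function c ^~ eta) xi.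
Proof.
move=> ax; have -> : (fun z : config => dual_function c xi z) =
    (fun z => (weight xi)^-1 * multi_opoly c xi z).
  by apply/funext => z; rewrite mulrC.
rewrite generatorZ /generator /dual_generator !gen_boundary_multi_opoly.
have -> : \sum_(p : V * V | (p.1 < p.2)%N && (omega G p.1 p.2 != 0))
    omega G p.1 p.2 * (rate xi p.1 p.2
      * (dual_function c (move p.1 p.2 xi) eta - dual_function c xi eta)
      + rate xi p.2 p.1
      * (dual_function c (move p.2 p.1 xi) eta - dual_function c xi eta)) =
    (weight xi)^-1
    * \sum_(p : V * V | (p.1 < p.2)%N && (omega G p.1 p.2 != 0))
        omega G p.1 p.2
        * gen_edge p.1 p.2 (fun z : config => multi_opoly c xi z) eta.
  rewrite mulr_sumr; apply: eq_bigr => -[x y] /= /andP[lt_xy _].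
  have xy : x != y by rewrite -val_eqE /= neq_ltn lt_xy.
  have yx : y != x by rewrite eq_sym.
  rewrite gen_edge_multi_opoly // 2!mulrBr -!descent_dual_function //.
  by rewrite /dual_function; ring.
have RL := descent_dual_function_remove c ord0 eta ax.
have RR := descent_dual_function_remove c ord_max eta ax.
have e (k o a t d u w q g : R) : d * u / w = k * g ->
    w^-1 * (o * (a * (t * d * u - k * q))) = t * (o * a * k * g)
      - o * a * k * (q / w).
  move=> h; have -> : t * (o * a * k * g) = t * o * a * (k * g) by ring.
  by rewrite -h; ring.
rewrite [LHS]mulrDr [X in X + _ = _]mulrDr.
rewrite (e _ _ _ _ _ _ _ _ _ RL) (e _ _ _ _ _ _ _ _ _ RR).
by rewrite /injection /killing {3}/dual_function; ring.
Qed.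

End Duality.

(** * Integration over a discrete space *)

Section DiscreteIntegration.
Context d (X : measurableType d) (R : realType).
Context (discrete : forall A : set X, measurable A).
Implicit Types (mu : probability X R) (f g : X -> R).

Lemma discrete_measurable_fun d' (U : sigmaRingType d') (h : X -> U) :
  measurable_fun [set: X] h.
Proof. by move=> _ Y _; exact: discrete. Qed.
#[local] Hint Resolve discrete_measurable_fun : core.

Definition rintegrable mu f := mu.-integrable [set: X] (EFin \o f).

Lemma rintegrable_le mu f g : rintegrable mu g ->
  (forall eta, `|f eta| <= g eta) -> rintegrable mu f.
Proof.
move=> ig fg; apply: le_integrable ig => // eta _ /=.
by rewrite lee_fin (le_trans (fg eta)) ?ler_norm.
Qed.

Lemma rintegrable_cst mu (c : R) : rintegrable mu (fun=> c).
Proof. exact: (finite_measure_integrable_cst mu c measurableT). Qed.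

Lemma rintegrableD mu f g : rintegrable mu f -> rintegrable mu g ->
  rintegrable mu (fun eta => f eta + g eta).
Proof. by move=> h1 h2; exact: (integrableD measurableT h1 h2). Qed.

Lemma rintegrableZ mu (c : R) f : rintegrable mu f ->
  rintegrable mu (fun eta => c * f eta).
Proof. by move=> h; exact: (integrableZl measurableT c h). Qed.

Lemma RintegralTD mu f g : rintegrable mu f -> rintegrable mu g ->
  \int[mu]_eta (f eta + g eta) = \int[mu]_eta f eta + \int[mu]_eta g eta.
Proof. exact: RintegralD measurableT. Qed.

Lemma RintegralTZ mu (c : R) f : rintegrable mu f ->
  \int[mu]_eta (c * f eta) = c * \int[mu]_eta f eta.
Proof. exact: RintegralZl measurableT. Qed.

Lemma Rintegral_const mu (c : R) : \int[mu]_(eta in [set: X]) c = c.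
Proof.
rewrite (Rintegral_cst mu measurableT) -[RHS]mulr1; congr (_ * _).
exact: (congr1 fine (probability_setT mu)).
Qed.

Lemma rintegrable_sum mu I (r : seq I) (P : pred I) (h : I -> X -> R) :
  (forall i, P i -> rintegrable mu (h i)) ->
  rintegrable mu (fun eta => \sum_(i <- r | P i) h i eta).
Proof.
move=> ih; rewrite (_ : (fun eta => _) = \sum_(i <- r | P i) h i); last first.
  by apply/funext => eta; rewrite fct_sumE.
elim/big_ind : _ => //; first exact: rintegrable_cst.
by move=> u v; exact: rintegrableD.
Qed.

Lemma Rintegral_sum mu I (r : seq I) (P : pred I) (h : I -> X -> R) :
  (forall i, P i -> rintegrable mu (h i)) ->
  \int[mu]_eta (\sum_(i <- r | P i) h i eta) =
  \sum_(i <- r | P i) \int[mu]_eta h i eta.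
Proof.
move=> ih; elim: r => [|i r IH].
  by under eq_Rintegral do rewrite big_nil; rewrite Rintegral_const big_nil.
rewrite big_cons -IH; case: ifPn => Pi; last first.
  by apply: eq_Rintegral => eta _; rewrite big_cons (negPf Pi).
rewrite -RintegralTD; [|exact: ih|exact: rintegrable_sum].
by apply: eq_Rintegral => eta _; rewrite big_cons Pi.
Qed.

Lemma expectationE mu f : 'E_mu[f]%E = (\int[mu]_eta (f eta)%:E)%E.
Proof. by rewrite unlock. Qed.

Lemma rintegrable_expectation mu f : rintegrable mu f ->
  'E_mu[f]%E = (\int[mu]_eta f eta)%:E.
Proof.
move=> h; have hfin := integrable_fin_num measurableT h.
by rewrite expectationE -[LHS](fineK hfin).
Qed.

Lemma indic_set1 (zeta eta : X) : \1_[set zeta] eta = (eta == zeta)%:R :> R.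
Proof.
rewrite indicE; congr (nat_of_bool _)%:R; apply/idP/eqP => [/set_mem //|->].
exact: mem_set.
Qed.

Lemma finite_support_sum f : finite_set [set eta | f eta != 0] ->
  exists r : seq X,
  f = fun eta => \sum_(zeta <- r) f zeta * \1_[set zeta] eta.
Proof.
move=> /finite_seqP[r hr]; exists (undup r); apply/funext => eta.
have mem_r : (eta \in r) = (f eta != 0).
  by have /(congr1 (fun A => A eta)) /= := hr => /propeqP e; apply/idP/idP => /e.
have [f0|f0] := eqVneq (f eta) 0.
  rewrite f0 big_seq big1 // => zeta; rewrite mem_undup indic_set1.
  by case: eqP => [<-|_]; rewrite ?mulr0 // mem_r f0 eqxx.
rewrite (bigD1_seq eta) ?undup_uniq //=; last by rewrite mem_undup mem_r.
rewrite indic_set1 eqxx mulr1 big1 ?addr0 // => zeta ne.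
by rewrite indic_set1 eq_sym (negPf ne) mulr0.
Qed.

Lemma finite_support_bounded f : finite_set [set eta | f eta != 0] ->
  exists M, forall eta, `|f eta| <= M.
Proof.
move=> /finite_support_sum[r ->]; exists (\sum_(zeta <- r) `|f zeta|) => eta.
apply: le_trans (ler_norm_sum _ _ _) _; apply: ler_sum => zeta _.
by rewrite normrM ler_piMr // indicE normr_nat lern1 leq_b1.
Qed.

Lemma rintegrable_bounded mu f M : (forall eta, `|f eta| <= M) ->
  rintegrable mu f.
Proof. by apply: rintegrable_le; exact: rintegrable_cst. Qed.

Lemma rintegrable_finite_support mu f : finite_set [set eta | f eta != 0] ->
  rintegrable mu f.
Proof. by move=> /finite_support_bounded[M]; exact: rintegrable_bounded. Qed.

Lemma Rintegral_set1 mu zeta :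
  \int[mu]_eta (\1_[set zeta] eta) = fine (mu [set zeta]).
Proof. by rewrite /Rintegral integral_indic // setIT. Qed.

(** By linearity it suffices to treat indicators of points, for which this is stationarity
    itself. *)
Lemma stationary_Rintegral (P : R -> X -> probability X R) mu t f :
  stationary P mu -> 0 <= t -> finite_set [set eta | f eta != 0] ->
  \int[mu]_eta (fine 'E_(P t eta)[f])%E = \int[mu]_eta f eta.
Proof.
move=> st t0 /finite_support_sum[r fE].
have i1 nu zeta : rintegrable nu (\1_[set zeta] : X -> R).
  apply: (@rintegrable_bounded _ _ 1) => eta.
  by rewrite indicE normr_nat lern1 leq_b1.
have Ef (nu : probability X R) :
    \int[nu]_eta f eta = \sum_(zeta <- r) f zeta * fine (nu [set zeta]).
  rewrite [in LHS]fE Rintegral_sum; last by move=> *; exact: rintegrableZ.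
  by apply: eq_bigr => zeta _; rewrite RintegralTZ // Rintegral_set1.
have P01 eta zeta : (0 <= fine (P t eta [set zeta]) <= 1)%R.
  rewrite fine_ge0 //= -lee_fin fineK ?probability_le1 //.
  exact: fin_num_measure.
have iP zeta : rintegrable mu (fun eta => fine (P t eta [set zeta])).
  apply: (@rintegrable_bounded _ _ 1) => eta.
  by have /andP[? ?] := P01 eta zeta; rewrite ger0_norm.
rewrite Ef; transitivity
  (\int[mu]_eta (\sum_(zeta <- r) f zeta * fine (P t eta [set zeta]))).
  by apply: eq_Rintegral => eta _; rewrite -Ef expectationE.
rewrite Rintegral_sum; last by move=> *; exact: rintegrableZ.
apply: eq_bigr => zeta _; rewrite RintegralTZ //; congr (_ * _).
rewrite -(st t [set zeta]) //; congr fine; apply: eq_integral => eta _.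
by rewrite fineK // fin_num_measure.
Qed.

Definition invariant_for (L : (X -> R) -> X -> R) mu : Prop :=
  forall f, finite_set [set eta | f eta != 0] ->
  rintegrable mu (L f) /\ \int[mu]_eta L f eta = 0.

(** The difference quotients of the semigroup have mean zero under mu and lie uniformly close to L
    f; both integrability and the zero mean pass to L f. *)
Lemma stationary_invariant (P : R -> X -> probability X R) L mu :
  has_generator P L -> stationary P mu -> invariant_for L mu.
Proof.
move=> gen st f fs; have ifin := rintegrable_finite_support mu fs.
have [M fM] := finite_support_bounded fs.
have approx (e : R) : 0 < e -> exists g : X -> R,
    [/\ rintegrable mu g, \int[mu]_eta g eta = 0 &
        forall eta, `|g eta - L f eta| <= e].
  move=> e0; have /filter_ex[t [t0 ht]] :
      \forall t \near (0 : R)^'+, 0 < t /\ forall eta,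
      `| (fine 'E_(P t eta)[f] - f eta) / t - L f eta | <= e.
    by apply: filterI; [exact: nbhs_right_gt|exact: gen].
  have iE : rintegrable mu (fun eta => fine 'E_(P t eta)[f]).
    apply: (@rintegrable_bounded _ _ M) => eta.
    rewrite expectationE; apply: le_trans (le_normr_Rintegral measurableT _) _.
      exact: rintegrable_finite_support.
    rewrite -[leRHS](Rintegral_const (P t eta)) le_Rintegral //.
    - by apply: (@rintegrable_bounded _ _ M) => z; rewrite normr_id.
    - exact: rintegrable_cst.
  exists (fun eta => (fine 'E_(P t eta)[f] - f eta) / t); split => //.
    rewrite (_ : (fun eta => _) = fun eta =>
      t^-1 * (fine 'E_(P t eta)[f]%E + (-1) * f eta)); last first.
      by apply/funext => eta; rewrite mulrC mulN1r.
    by apply: rintegrableZ; apply: rintegrableD => //; exact: rintegrableZ.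
  transitivity (\int[mu]_eta
      (t^-1 * (fine 'E_(P t eta)[f]%E + (-1) * f eta))).
    by apply: eq_Rintegral => eta _; rewrite mulrC mulN1r.
  have ifN := rintegrableZ (-1) ifin.
  rewrite RintegralTZ ?RintegralTD ?RintegralTZ //; last exact: rintegrableD.
  by rewrite (stationary_Rintegral st (ltW t0) fs) mulN1r subrr mulr0.
have iL : rintegrable mu (L f).
  have [g [ig _ gL]] := approx 1 ltr01.
  apply: (@rintegrable_le _ _ (fun eta => `|g eta| + 1)).
    apply: rintegrableD; last exact: rintegrable_cst.
    by apply: (integrable_norm ig).
  move=> eta; rewrite -[L f eta](subrK (g eta)) addrC.
  by apply: le_trans (ler_normD _ _) _; rewrite lerD2l distrC.
split => //; apply/eqP; rewrite -normr_le0; apply/ler_addgt0Pl => e e0.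
rewrite addr0; have [g [ig g0 gL]] := approx e e0.
have id : rintegrable mu (fun eta => L f eta + (-1) * g eta).
  by apply: rintegrableD => //; exact: rintegrableZ.
have -> : \int[mu]_eta L f eta = \int[mu]_eta (L f eta + (-1) * g eta).
  rewrite RintegralTD ?RintegralTZ ?g0 ?mulr0 ?addr0 //.
  exact: rintegrableZ.
apply: le_trans (le_normr_Rintegral measurableT id) _.
rewrite -[leRHS](Rintegral_const mu) le_Rintegral //.
- exact: (integrable_norm id).
- exact: rintegrable_cst.
- by move=> eta _; rewrite mulN1r distrC.
Qed.

(** Monotone convergence for truncations that become exact at each point. *)
Lemma rintegrable_exhaustion mu (F : nat -> X -> R) f (C : R) :
  (forall k, rintegrable mu (F k)) -> (forall k x, 0 <= F k x) ->
  (forall x, {homo F ^~ x : k l / (k <= l)%N >-> k <= l}) ->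
  (forall x, \forall k \near \oo, F k x = f x) ->
  (forall k, \int[mu]_x F k x <= C) -> rintegrable mu f.
Proof.
move=> iF F0 homoF cvgF FC.
have limF x : limn (fun k => (F k x)%:E) = (f x)%:E.
  apply/cvg_lim => //; apply: cvg_near_cst.
  by apply: filterS (cvgF x) => k ->.
have f0 x : 0 <= f x by have [k <-] := filter_ex (cvgF x).
apply/integrableP; split => //.
have := @cvg_monotone_convergence _ _ _ mu setT measurableT
  (fun k x => (F k x)%:E).
move=> /(_ (fun k => discrete_measurable_fun _)).
move=> /(_ (fun k x _ => F0 k x)) /(_ (fun x _ k l kl => homoF x k l kl)) cvgI.
apply: le_lt_trans (ltry C).
have -> : (\int[mu]_x `|(EFin \o f) x|)%E =
    (\int[mu]_x limn (fun k => (F k x)%:E))%E.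
  by apply: eq_integral => x _ /=; rewrite limF ger0_norm.
rewrite -(cvg_lim _ cvgI) //; apply: lime_le.
  by apply/cvg_ex; eexists; exact: cvgI.
apply: nearW => k; have fk := integrable_fin_num measurableT (iF k).
by rewrite -[leLHS](fineK fk) lee_fin; exact: FC.
Qed.

(** Serves to remove a cut-off from an invariance relation, by dominated convergence. *)
Lemma Rintegral_dominated0 mu (F : nat -> X -> R) f g :
  (forall k, \int[mu]_x F k x = 0) -> rintegrable mu g ->
  (forall k x, `|F k x| <= g x) ->
  (forall x, \forall k \near \oo, F k x = f x) ->
  rintegrable mu f /\ \int[mu]_x f x = 0.
Proof.
move=> F0 ig Fg cvgF.
have iF k : rintegrable mu (F k) by exact: rintegrable_le (Fg k).
have [||if_ _ cvgI] := @dominated_convergence _ _ _ mu setT measurableT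
  (fun k x => (F k x)%:E) (EFin \o f) (EFin \o g)
  (fun k => discrete_measurable_fun _) (discrete_measurable_fun _) _ ig.
- by apply: aeW => x _; apply: cvg_near_cst; apply: filterS (cvgF x) => k /= ->.
- by apply: aeW => x k _; rewrite lee_fin.
split; first exact: if_.
have I0 : (fun k => \int[mu]_x (F k x)%:E)%E = (fun=> 0%E).
  apply/funext => k; have fk := integrable_fin_num measurableT (iF k).
  by rewrite -[LHS](fineK fk); congr EFin; exact: F0.
have := cvg_lim (@ereal_hausdorff R) cvgI; rewrite I0 lim_cst // => e.
exact: (congr1 fine (esym (e _))).
Qed.

End DiscreteIntegration.

(** * Lyapunov weights *)

Section LyapunovWeights.
Context (R : realType) (N : nat) (sigma : int) (G : geometry R N).
Local Notation V := 'I_N.+1.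
Local Notation conf := {ffun V -> nat}.
Local Notation adm := (admissible sigma G).
Local Notation rate := (hop_rate sigma G).
Local Notation K := (dual_generator sigma G).
Implicit Types (xi : conf) (g : conf -> R).

(** Jumps with nonzero rate stay among admissible configurations of the same mass, so the dual
    generator acts as a matrix on each level. *)
Lemma dual_generator_eq n g1 g2 xi :
  (forall z, adm z -> mass z = n -> g1 z = g2 z) ->
  adm xi -> mass xi = n -> K g1 xi = K g2 xi.
Proof.
move=> h ax mx; rewrite !dual_generatorE (h xi) //; congr (_ - _).
apply: eq_bigr => -[x y] _ /=; have [->|xy] := eqVneq x y.
  by rewrite omega_diag !mul0r.
have [->|r0] := eqVneq (rate xi x y) 0; first by rewrite !mul0r.
rewrite h //; first exact: move_admissible.
rewrite mass_move // lt0n; apply: contraNneq r0 => e.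
by rewrite /hop_rate e mul0r.
Qed.

Lemma dual_generator_sum k (a : 'I_k -> R) (g : 'I_k -> conf -> R) xi :
  K (fun z => \sum_j a j * g j z) xi = \sum_j a j * K (g j) xi.
Proof.
rewrite dual_generatorE; under [RHS]eq_bigr do
  rewrite dual_generatorE mulrBr mulr_sumr.
rewrite sumrB exchange_big /=; congr (_ - _); last first.
  by rewrite mulr_sumr; apply: eq_bigr => j _; rewrite mulrCA.
apply: eq_bigr => p _; rewrite -sumrB !mulr_sumr.
by apply: eq_bigr => j _; ring.
Qed.

(** Free of repetitions, so that it can index the rows of a matrix. *)
Definition admissible_level n : seq conf :=
  undup [seq xi <- level N n | adm xi].

Lemma mem_admissible_level n xi :
  (xi \in admissible_level n) = adm xi && (mass xi == n).
Proof. by rewrite mem_undup mem_filter mem_level. Qed.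

Context (hsigma : sigma \in [:: -1; 0; 1]).
Context (hG : 0 < Num.max (omegaL G) (omegaR G)).

(* By the minimum principle the matrix of K on a level is invertible and minus
   its inverse has nonnegative entries; h is the vector of column sums of the
   latter. *)
Lemma lyapunov_weights n : (0 < n)%N -> exists h : conf -> R,
  (forall xi, adm xi -> mass xi = n -> 0 < h xi) /\
  forall g, \sum_(xi <- admissible_level n) h xi * K g xi =
            - \sum_(xi <- admissible_level n) g xi.
Proof.
move=> n0; pose r := admissible_level n; pose k := size r.
pose e (i : 'I_k) : conf := nth [ffun=> 0%N] r i.
have er i : adm (e i) /\ mass (e i) = n.
  have : e i \in r by exact: mem_nth.
  by rewrite mem_admissible_level => /andP[? /eqP].
have ex xi : adm xi -> mass xi = n -> exists i, xi = e i.
  move=> ax mx; have xr : xi \in r by rewrite mem_admissible_level ax mx eqxx.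
  have := xr; rewrite -index_mem => lt; exists (Ordinal lt).
  by rewrite /e nth_index.
have eE i j : (e i == e j) = (i == j).
  by rewrite /e nth_uniq // undup_uniq.
have sumE (F : conf -> R) : \sum_(xi <- r) F xi = \sum_i F (e i).
  by rewrite (big_nth [ffun=> 0%N]) big_mkord.
have pick (a : 'I_k -> R) i : \sum_j a j * (e i == e j)%:R = a i.
  rewrite (bigD1 i) //= eqxx mulr1 big1 ?addr0 // => j ji.
  by rewrite eE eq_sym (negPf ji) mulr0.
pose M : 'M[R]_k := \matrix_(i, j) K (fun z => (z == e j)%:R) (e i).
pose fn (v : 'cV[R]_k) z := \sum_j v j 0 * (z == e j)%:R.
have KM (v : 'cV[R]_k) i : K (fn v) (e i) = (M *m v) i 0.
  rewrite dual_generator_sum mxE; apply: eq_bigr => j _.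
  by rewrite mxE mulrC.
have pos (v : 'cV[R]_k) : (forall i, (M *m v) i 0 <= 0) -> forall i, 0 <= v i 0.
  move=> hv i; have [ai mi] := er i.
  rewrite -(pick (fun j => v j 0) i) -/(fn v (e i)).
  apply: (minimum_principle hsigma hG n0) ai mi => z az mz.
  by have [j ->] := ex z az mz; rewrite KM.
(* The minimum principle applies to both v and -v. *)
have inj (v : 'cV[R]_k) : M *m v = 0 -> v = 0.
  move=> Mv; apply/colP => i; rewrite [RHS]mxE; apply/eqP; rewrite eq_le.
  rewrite pos => [|j]; last by rewrite Mv mxE.
  rewrite andbT -oppr_ge0; have := pos (- v); rewrite mulmxN Mv.
  by move=> /(_ _ i); rewrite !mxE; apply => j; rewrite !mxE oppr0.
have uM : M \in unitmx.
  rewrite -unitmx_tr -row_free_unit; apply: inj_row_free => u /(congr1 trmx).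
  by rewrite trmx_mul trmxK trmx0 => /inj /(congr1 trmx); rewrite trmxK trmx0.
pose hv : 'rV[R]_k := - (const_mx 1 *m invmx M).
have hvM : hv *m M = - const_mx 1 by rewrite mulNmx -mulmxA mulVmx // mulmx1.
have hv_gt0 j : 0 < hv 0 j.
  (* Column j of minus the inverse is nonnegative and, since M maps it to a nonzero vector, not
     zero; its sum is therefore positive. *)
  pose v := - (invmx M *m delta_mx j 0 : 'cV[R]_k).
  have Mv : M *m v = - delta_mx j 0 by rewrite mulmxN mulKVmx.
  have v0 : forall i, 0 <= v i 0.
    by apply: pos => i; rewrite Mv !mxE oppr_le0 ler0n.
  have -> : hv 0 j = \sum_i v i 0.
    rewrite !mxE -sumrN; apply: eq_bigr => i _.
    by rewrite /v -colE !mxE mul1r.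
  rewrite lt_def sumr_ge0 // andbT; apply/negP => /eqP.
  move=> /(psumr_eq0P (fun i _ => v0 i)) hz.
  have vz : v = 0 by apply/colP => i; rewrite hz // mxE.
  move: Mv; rewrite vz mulmx0 => /matrixP/(_ j 0).
  rewrite !mxE !eqxx /= => /eqP; rewrite eq_sym oppr_eq0 oner_eq0 //.
exists (fun z => \sum_j hv 0 j * (z == e j)%:R); split.
  by move=> xi ax mx; have [i ->] := ex xi ax mx; rewrite pick.
move=> g; rewrite -/r !sumE.
pose vg : 'cV[R]_k := \col_i g (e i).
transitivity ((hv *m (M *m vg)) 0 0).
  rewrite mxE; apply: eq_bigr => i _; rewrite pick -KM; congr (_ * _).
  have [ai mi] := er i; apply: (dual_generator_eq (n := n)) => // z az mz.
  have [j ->] := ex z az mz; rewrite /fn (pick (fun j => vg j 0)).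
  by rewrite mxE.
rewrite mulmxA hvM mulNmx !mxE; congr (- _).
by apply: eq_bigr => i _; rewrite !mxE mul1r.
Qed.

End LyapunovWeights.

(** * Moments of the stationary measure *)

Lemma opoly0_ffact (R : comNzRingType) (s al : R) k (a : nat) :
  opoly s 0 al k a%:R = (a ^_ k)%:R.
Proof.
elim: k => [|k IH]; first by rewrite ffactn0.
rewrite opolyS IH ffactnSr natrM.
have [ka|ak] := leqP k a; first by rewrite natrB //; ring.
by rewrite ffact_small //; ring.
Qed.

(** Turns a bound on a falling factorial into a bound on its argument: above n the last factor is a
    - n and the others are at least 1. *)
Lemma leq_ffactD (a n : nat) : (a <= a ^_ n.+1 + n)%N.
Proof.
have [an|na] := leqP a n; first exact: leq_trans an (leq_addl _ _).
rewrite ffactnSr addnC -leq_subLR leq_pmull //.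
by rewrite ffact_gt0 ltnW.
Qed.

Section Moments.
Context (R : realType) (N : nat) (sigma : int) (G : geometry R N).
Context (hsigma : sigma \in [:: -1; 0; 1]).
Context (hG : 0 < Num.max (omegaL G) (omegaR G)).
Local Notation V := 'I_N.+1.
Local Notation conf := {ffun V -> nat}.
Local Notation config := (config sigma G).
Local Notation adm := (admissible sigma G).
Local Notation K := (dual_generator sigma G).
Local Notation multi_opoly := (multi_opoly sigma G).
Local Notation dual_function := (dual_function sigma G).
Implicit Types (xi : conf) (eta : config) (f g : config -> R).

Lemma config_discrete (A : set config) : measurable A.
Proof. by []. Qed.
Local Notation dsc := config_discrete.

Lemma finite_bounded_configs (M : nat) :
  finite_set [set eta : config | forall x, (eta x <= M)%N].
Proof.
pose F (u : {ffun V -> 'I_M.+1}) : config :=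
  insubd (Config (admissible0 sigma G)) [ffun x => nat_of_ord (u x)].
apply: (@sub_finite_set _ _ (F @` setT)).
  move=> eta h; exists [ffun x => inord (eta x)] => //.
  have e : [ffun x => nat_of_ord ([ffun x => inord (eta x)] x : 'I_M.+1)] =
      occupation eta by apply/ffunP => x; rewrite !ffunE inordK // ltnS h.
  by rewrite /F e; exact: (valKd _ eta).
by apply: finite_image; exact: finite_finset.
Qed.

Lemma exclusion_finite : sigma = -1 -> finite_set [set: config].
Proof.
move=> e; apply: sub_finite_set (finite_bounded_configs (\sum_x alpha G x)).
move=> eta _ x /=; have /admissibleP/(_ e x) := config_admissible eta.
by move=> /leq_trans; apply; rewrite (bigD1 x) //= leq_addr.
Qed.

Lemma multi_opoly0_ge0 xi (eta : conf) : 0 <= multi_opoly 0 xi eta.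
Proof. by apply: prodr_ge0 => x _; rewrite opoly0_ffact. Qed.

Lemma multi_opoly_empty c (eta : conf) : multi_opoly c [ffun=> 0%N] eta = 1.
Proof. by rewrite /multi_opoly big1 // => x _; rewrite ffunE. Qed.

Lemma generator_sum tL tR I (r : seq I) (h : I -> config -> R) eta :
  generator tL tR (fun z => \sum_(i <- r) h i z) eta =
  \sum_(i <- r) generator tL tR (h i) eta.
Proof.
elim: r => [|i r IH].
  rewrite big_nil generatorE big1 // => i _.
  by rewrite !big_nil subrr mulr0.
rewrite big_cons -IH -generatorD; congr (generator _ _ _ _).
by apply/funext => z; rewrite big_cons.
Qed.

Context (tL tR : R) (hL : Theta R sigma tL) (hR : Theta R sigma tR).

Lemma Theta_ge0 t : Theta R sigma t -> 0 <= t.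
Proof.
by rewrite /Theta; case: ifP => _ /=; rewrite in_itv /= => /andP[].
Qed.

Context (mu : probability config R).
Context (inv : invariant_for (generator tL tR) mu).

(* With the Lyapunov weights h, H = sum h D satisfies L H = B - S, where S is
   the sum of all the D of the given level and B involves only the previous level.
   Invariance applied to min(H, M) - M, which is finitely supported, gives
   int_(H < M) S <= int B for all M. *)
Lemma dual_function_integrable n xi : sigma != -1 -> mass xi = n ->
  rintegrable mu (dual_function 0 xi).
Proof.
move=> sN; have admT z : adm z by apply/admissibleP => e; rewrite e eqxx in sN.
elim: n xi => [|n IH] xi mx.
  rewrite (mass0 mx); apply: (@rintegrable_le _ _ _ dsc _ _
    (fun=> (weight sigma G [ffun=> 0%N])^-1)); first exact: rintegrable_cst.
  move=> eta; rewrite /dual_function multi_opoly_empty mul1r ger0_norm //.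
  by rewrite invr_ge0 ltW ?weight_gt0.
have [h [h0 hK]] := lyapunov_weights hsigma hG (ltn0Sn n).
have {}h0 z : mass z = n.+1 -> 0 < h z by exact: h0.
set r := admissible_level sigma G n.+1 in hK.
have mr z : z \in r -> mass z = n.+1.
  by rewrite mem_admissible_level => /andP[_ /eqP].
have D0 z (eta : conf) : 0 <= dual_function 0 z eta.
  by rewrite divr_ge0 ?multi_opoly0_ge0 // ltW ?weight_gt0.
pose H (eta : config) := \sum_(z <- r) h z * dual_function 0 z eta.
pose S (eta : config) := \sum_(z <- r) dual_function 0 z eta.
pose B (eta : config) :=
  \sum_(z <- r) h z * injection G tL tR (dual_function 0 ^~ eta) z.
have LH eta : generator tL tR H eta = B eta - S eta.
  rewrite /H generator_sum -hK -big_split; apply: eq_bigr => z _ /=.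
  by rewrite generatorZ duality // !subr0; ring.
have irem z x (c : R) : mass z = n.+1 -> rintegrable mu
    (fun eta : config => c * (z x)%:R * dual_function 0 (remove x z) eta).
  move=> mz; have [zx|zx] := posnP (z x).
    apply: (@rintegrable_bounded _ _ _ dsc _ _ 0) => eta.
    by rewrite zx mulr0 mul0r normr0.
  apply: rintegrableZ; apply: IH.
  by apply/eqP; rewrite -eqSS mass_remove // mz.
have iB : rintegrable mu B.
  have -> : B = fun eta => \sum_(z <- r | z \in r)
      h z * injection G tL tR (dual_function 0 ^~ eta) z.
    by apply/funext => eta; rewrite /B big_seq.
  apply: rintegrable_sum => z /mr mz; apply: rintegrableZ.
  by apply: rintegrableD; apply: rintegrableZ; exact: irem.
have B0 eta : 0 <= B eta.
  rewrite /B big_seq; apply: sumr_ge0 => z /mr /h0 /ltW hz.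
  have D0' x : 0 <= dual_function 0 (remove x z) eta by exact: D0.
  have [aL aR] := (ltW (alphaL_gt0 G), ltW (alphaR_gt0 G)).
  have [tL0 tR0] := (Theta_ge0 hL, Theta_ge0 hR).
  apply: mulr_ge0 => //; apply: addr_ge0; apply: mulr_ge0 => //;
    apply: mulr_ge0 => //; apply: mulr_ge0 => //; apply: mulr_ge0 => //.
  - exact: omegaL_ge0.
  - exact: omegaR_ge0.
have S0 eta : 0 <= S eta by apply: sumr_ge0.
have term_le z eta : mass z = n.+1 -> h z * dual_function 0 z eta <= H eta.
  move=> mz; have zr : z \in r by rewrite mem_admissible_level mz admT eqxx.
  rewrite /H (bigD1_seq z) ?undup_uniq //= lerDl big_seq_cond sumr_ge0 // => y.
  by move=> /andP[/mr/h0/ltW hy _]; rewrite mulr_ge0.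
have finH (M : nat) : finite_set [set eta : config | H eta < M%:R].
  (* With all n + 1 dual particles at x, the dual function is a multiple of a falling factorial of
     the occupation of x. A bound on H thus bounds every coordinate. *)
  pose p x : conf := [ffun z => ((z == x) * n.+1)%N].
  have mp x : mass (p x) = n.+1.
    rewrite /mass (bigD1 x) //= ffunE eqxx mul1n big1 ?addn0 // => y yx.
    by rewrite ffunE (negPf yx).
  pose c x := M%:R * weight sigma G (p x) / h (p x).
  apply: sub_finite_set
    (finite_bounded_configs (\sum_x (Num.bound (c x) + n))) => eta /= HM x.
  suff hx : (eta x <= Num.bound (c x) + n)%N.
    by apply: leq_trans hx _; rewrite (bigD1 x) //= leq_addr.
  apply: leq_trans (leq_ffactD _ n) _; rewrite leq_add2r -(ler_nat R).
  have hp := h0 _ (mp x); have wp := weight_gt0 hsigma (admT (p x)).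
  have c0 : 0 <= c x by rewrite divr_ge0 ?mulr_ge0 // ltW.
  apply: le_trans (ltW (archi_boundP c0)).
  have : h (p x) * dual_function 0 (p x) eta <= M%:R.
    exact: le_trans (term_le _ _ (mp x)) (ltW HM).
  rewrite /dual_function /multi_opoly (bigD1 x) //= ffunE eqxx mul1n.
  rewrite opoly0_ffact big1 ?mulr1 => [|y /negPf yx]; last by rewrite ffunE yx.
  by rewrite mulrA ler_pdivrMr // mulrC -ler_pdivlMr.
pose f (M : nat) (eta : config) : R := Num.min (H eta) M%:R - M%:R.
pose SM (M : nat) (eta : config) : R := if H eta < M%:R then S eta else 0.
have fin_f M : finite_set [set eta : config | f M eta != 0].
  apply: sub_finite_set (finH M) => eta /=; rewrite /f ltNge.
  by apply: contra => MH; rewrite (min_idPr MH) subrr.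
have fin_SM M : finite_set [set eta : config | SM M eta != 0].
  apply: sub_finite_set (finH M) => eta /=; rewrite /SM.
  by case: ifP => // _; rewrite eqxx.
have iSM M := rintegrable_finite_support dsc mu (fin_SM M).
(* Below M the truncation agrees with H - M at eta and is at most H - M at every target, so its
   generator is at most B - S. At or above M it has its maximal value 0, so its generator is at most
   0. *)
have drift M eta : generator tL tR (f M) eta + SM M eta <= B eta.
  rewrite /SM; case: ifPn => [HM|]; last rewrite -leNgt => HM.
    rewrite -(subrK (S eta) (B eta)) -LH lerD2r !generatorE.
    apply: ler_sum => i _; apply: ler_wpM2l.
      exact: transition_rate_ge0.
    rewrite /f [Num.min (H eta) _](min_idPl (ltW HM)) opprB addrA subrK lerD2r.
    by rewrite ge_min lexx.
  rewrite addr0; apply: le_trans (B0 eta); rewrite generatorE.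
  apply: sumr_le0 => i _; apply: mulr_ge0_le0.
    exact: transition_rate_ge0.
  rewrite /f [Num.min (H eta) _](min_idPr HM) subrr subr0 subr_le0.
  by rewrite ge_min lexx orbT.
have iS : rintegrable mu S.
  apply: (@rintegrable_exhaustion _ _ _ dsc mu SM S (\int[mu]_eta B eta)) => //.
  - by move=> M eta; rewrite /SM; case: ifP.
  - move=> eta M M' MM'; rewrite /SM; case: ifPn => [HM|_].
      by rewrite (lt_le_trans HM) ?ler_nat.
    by case: ifP.
  - move=> eta; exists (Num.bound (H eta)) => // M /= bM; rewrite /SM.
    rewrite (lt_le_trans (archi_boundP _)) ?ler_nat //.
    rewrite /H big_seq; apply: sumr_ge0 => z /mr/h0/ltW hz.
    exact: mulr_ge0.
  - move=> M; have [iL L0] := inv (fin_f M).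
    rewrite -[leLHS]add0r -L0 -RintegralTD //.
    apply: le_Rintegral => //; first exact: rintegrableD.
apply: (rintegrable_le dsc iS) => eta; rewrite ger0_norm //.
have xr : xi \in r by rewrite mem_admissible_level mx admT eqxx.
by rewrite /S (bigD1_seq xi) ?undup_uniq //= lerDl sumr_ge0.
Qed.

Lemma falling_integrable xi : rintegrable mu (multi_opoly 0 xi).
Proof.
(* Exclusion has a finite state space; otherwise all weights are positive and can be multiplied
   back. *)
have [e|sN] := eqVneq sigma (-1).
  apply: rintegrable_finite_support => //.
  exact: sub_finite_set (exclusion_finite e).
have ax : adm xi by apply/admissibleP => e; rewrite e eqxx in sN.
have w0 : weight sigma G xi != 0 by rewrite gt_eqF ?weight_gt0.
have := rintegrableZ (weight sigma G xi)
  (dual_function_integrable sN (erefl (mass xi))).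
have -> // : (fun eta : config => weight sigma G xi * dual_function 0 xi eta) =
    (fun eta : config => multi_opoly 0 xi eta).
by apply/funext => eta; rewrite mulrC divfK.
Qed.

End Moments.

(** * Stationary equations *)

Section Polynomials.
Context (R : realType) (N : nat) (sigma : int) (G : geometry R N).
Local Notation V := 'I_N.+1.
Local Notation conf := {ffun V -> nat}.
Local Notation config := (config sigma G).
Local Notation s := (sigma%:~R : R).
Local Notation multi_opoly := (multi_opoly sigma G).
Implicit Types (xi : conf) (eta : config) (f g : config -> R).

(** Polynomials are presented as the span of products of falling factorials. These are nonnegative
    and integrable, so integrability and invariance are proved for them and extend by linearity. *)
Inductive polynomial_fun : (config -> R) -> Prop :=
| polynomial_falling xi : polynomial_fun (fun eta => multi_opoly 0 xi eta)
| polynomialD f g : polynomial_fun f -> polynomial_fun g ->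
    polynomial_fun (fun eta => f eta + g eta)
| polynomialZ c f : polynomial_fun f -> polynomial_fun (fun eta => c * f eta).

Lemma polynomial_ext f g : f =1 g -> polynomial_fun f -> polynomial_fun g.
Proof. by move=> /funext ->. Qed.

Lemma polynomial_cst c : polynomial_fun (fun=> c).
Proof.
apply: polynomial_ext (polynomialZ c (polynomial_falling [ffun=> 0%N])).
by move=> eta; rewrite multi_opoly_empty mulr1.
Qed.

Lemma polynomial_sum I (r : seq I) (h : I -> config -> R) :
  (forall i, polynomial_fun (h i)) ->
  polynomial_fun (fun eta => \sum_(i <- r) h i eta).
Proof.
move=> hh; elim: r => [|i r IH].
  by apply: polynomial_ext (polynomial_cst 0) => eta; rewrite big_nil.
by apply: polynomial_ext (polynomialD (hh i) IH) => eta; rewrite big_cons.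
Qed.

Lemma multi_opoly0_add x xi (eta : conf) : multi_opoly 0 (add x xi) eta =
  ((eta x)%:R - (xi x)%:R) * multi_opoly 0 xi eta.
Proof.
rewrite /multi_opoly (bigD1 x) //= [in RHS](bigD1 x) //= mulrA; congr (_ * _).
  by rewrite ffunE eqxx addn1 opolyS; ring.
by apply: eq_bigr => z /negPf zx; rewrite ffunE zx addn0.
Qed.

Lemma polynomial_occupation x f : polynomial_fun f ->
  polynomial_fun (fun eta => (eta x)%:R * f eta).
Proof.
elim=> [xi|g h _ IHg _ IHh|c g _ IH].
- apply: polynomial_ext (polynomialD (polynomial_falling (add x xi))
    (polynomialZ (xi x)%:R (polynomial_falling xi))) => eta.
  by rewrite multi_opoly0_add; ring.
- by apply: polynomial_ext (polynomialD IHg IHh) => eta; rewrite mulrDr.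
- by apply: polynomial_ext (polynomialZ c IH) => eta; rewrite mulrCA.
Qed.

Lemma polynomial_slope (a b : R) x f : polynomial_fun f ->
  polynomial_fun (fun eta => (a + b * (eta x)%:R) * f eta).
Proof.
move=> pf; apply: polynomial_ext (polynomialD (polynomialZ a pf)
  (polynomialZ b (polynomial_occupation x pf))) => eta; ring.
Qed.

Lemma polynomial_transition_rate tL tR i f : polynomial_fun f ->
  polynomial_fun (fun eta => transition_rate tL tR i eta * f eta).
Proof.
move=> pf; case: i => [[x y]|[[] []]] /=.
- apply: polynomial_ext (polynomialZ (omega G x y) (polynomial_occupation x
    (polynomial_slope (alpha G y)%:R s y pf))) => eta; rewrite /hop_rate; ring.
- apply: polynomial_ext (polynomialZ (omegaL G * (alphaL G * (1 + s * tL)))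
    (polynomial_occupation ord0 pf)) => eta; ring.
- apply: polynomial_ext (polynomialZ (omegaL G * (alphaL G * tL))
    (polynomial_slope (alpha G ord0)%:R s ord0 pf)) => eta; ring.
- apply: polynomial_ext (polynomialZ (omegaR G * (alphaR G * (1 + s * tR)))
    (polynomial_occupation ord_max pf)) => eta; ring.
- apply: polynomial_ext (polynomialZ (omegaR G * (alphaR G * tR))
    (polynomial_slope (alpha G ord_max)%:R s ord_max pf)) => eta; ring.
Qed.

Lemma polynomial_opoly c x k f : polynomial_fun f ->
  polynomial_fun (fun eta => opoly s c (alpha G x)%:R k (eta x)%:R * f eta).
Proof.
move=> pf.
suff [//] : polynomial_fun
    (fun eta => opoly s c (alpha G x)%:R k (eta x)%:R * f eta) /\
  polynomial_fun
    (fun eta => opoly s c (alpha G x)%:R k.+1 (eta x)%:R * f eta).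
elim: k => [|k [IH0 IH1]].
  split; first by apply: polynomial_ext pf => eta; rewrite mul1r.
  apply: polynomial_ext
    (polynomial_slope (- (c * (alpha G x)%:R)) 1 x pf) => eta.
  by rewrite opolyS /lowered /=; ring.
split=> //.
apply: polynomial_ext (polynomialD (polynomial_slope
  (- (c * (alpha G x)%:R + (1 + 2 * s * c) * k.+1%:R)) 1 x IH1)
  (polynomialZ (- (c * (1 + s * c)
     * (k.+1%:R * ((alpha G x)%:R + s * k%:R)))) IH0)) => eta.
rewrite [opoly _ _ _ k.+2 _]opolyS /lowered -pred_Sn.
set u := opoly _ _ _ k _; set v := opoly _ _ _ k.+1 _; ring.
Qed.

Lemma polynomial_multi_opoly c xi :
  polynomial_fun (fun eta => multi_opoly c xi eta).
Proof.
rewrite /multi_opoly; elim: (index_enum _) => [|x r IH].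
  by apply: polynomial_ext (polynomial_cst 1) => eta; rewrite big_nil.
by apply: polynomial_ext (polynomial_opoly c x (xi x) IH) => eta;
  rewrite big_cons.
Qed.

Lemma polynomial_generator_opoly tL tR c xi :
  polynomial_fun (generator tL tR (fun eta => multi_opoly c xi eta)).
Proof.
(* The value 0 on the diagonal makes [p x y] polynomial for all pairs: the formula for the edge
   generator needs distinct sites. *)
pose p (x : V) (y : V) eta := omega G x y *
  (if x == y then 0 else gen_edge x y (fun z => multi_opoly c xi z) eta).
have poly_edge x y : polynomial_fun (p x y).
  apply: polynomialZ; case: eqVneq => [_|xy]; first exact: polynomial_cst.
  apply: (@polynomial_ext (fun eta =>
    descent sigma G xi x * multi_opoly c (move x y xi) eta
    + (descent sigma G xi y * multi_opoly c (move y x xi) eta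
    + - (hop_rate sigma G xi x y + hop_rate sigma G xi y x)
      * multi_opoly c xi eta))).
    by move=> eta; rewrite gen_edge_multi_opoly //; ring.
  by do 2?apply: polynomialD; apply: polynomialZ; exact: polynomial_multi_opoly.
have poly_boundary w a t x : polynomial_fun (fun eta =>
    w * gen_boundary a t x (fun z => multi_opoly c xi z) eta).
  apply: polynomialZ; apply: (@polynomial_ext (fun eta =>
    (a * ((t - c) * descent sigma G xi x)) * multi_opoly c (remove x xi) eta
    + (- (a * (xi x)%:R)) * multi_opoly c xi eta)).
    by move=> eta; rewrite gen_boundary_multi_opoly; ring.
  by apply: polynomialD; apply: polynomialZ; exact: polynomial_multi_opoly.
apply: (@polynomial_ext (fun eta =>
  \sum_(q <- [seq q : V * V <- index_enum _ |
     (q.1 < q.2)%N && (omega G q.1 q.2 != 0)]) p q.1 q.2 eta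
  + (omegaL G * gen_boundary (alphaL G) tL ord0
      (fun z => multi_opoly c xi z) eta
  + omegaR G * gen_boundary (alphaR G) tR ord_max
      (fun z => multi_opoly c xi z) eta))).
  move=> eta; rewrite /generator addrA big_filter; congr (_ + _ + _).
  apply: eq_bigr => -[x y] /= /andP[lt_xy _]; rewrite /p ifN //.
  by rewrite -val_eqE /= neq_ltn lt_xy.
do 2?apply: polynomialD; rewrite //.
by apply: polynomial_sum => q; exact: poly_edge.
Qed.

End Polynomials.

(** * Invariance on polynomials and the equations for the dual moments *)

Section StationaryEquations.
Context (R : realType) (N : nat) (sigma : int) (G : geometry R N).
Context (hsigma : sigma \in [:: -1; 0; 1]).
Context (hG : 0 < Num.max (omegaL G) (omegaR G)).
Local Notation V := 'I_N.+1.
Local Notation conf := {ffun V -> nat}.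
Local Notation config := (config sigma G).
Local Notation adm := (admissible sigma G).
Local Notation multi_opoly := (multi_opoly sigma G).
Local Notation dual_function := (dual_function sigma G).
Implicit Types (xi : conf) (eta : config) (f g : config -> R).
Context (tL tR : R) (hL : Theta R sigma tL) (hR : Theta R sigma tR).
Context (mu : probability config R).
Context (inv : invariant_for (generator tL tR) mu).
Local Notation dsc := (@config_discrete R N sigma G).

Lemma polynomial_integrable f : polynomial_fun f -> rintegrable mu f.
Proof.
elim=> [xi|g h _ IHg _ IHh|c g _ IH].
- exact: (falling_integrable hsigma hG hL hR inv).
- exact: rintegrableD.
- exact: rintegrableZ.
Qed.

(** Cutting Q off at total mass k gives a finitely supported function, to which invariance applies;
    the cut-off is then removed by domination. *)
Lemma falling_invariant xi : let Q eta := multi_opoly 0 xi eta in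
  rintegrable mu (generator tL tR Q) /\ \int[mu]_eta generator tL tR Q eta = 0.
Proof.
move=> Q.
pose F (k : nat) := generator tL tR
  (fun eta : config => if (mass eta <= k)%N then Q eta else 0).
(* The increment of a cut-off Q along a transition is at most Q(target) + Q(eta) in absolute value,
   which is the increment of Q plus 2 Q(eta). Summed against the rates this is [g], a polynomial. *)
pose g eta := generator tL tR Q eta
  + 2 * \sum_i transition_rate tL tR i eta * Q eta.
have Q0 eta : 0 <= Q eta by exact: multi_opoly0_ge0.
apply: (@Rintegral_dominated0 _ _ _ dsc mu F _ g).
- move=> k; apply: (inv _).2.
  apply: sub_finite_set (@finite_bounded_configs R N sigma G k) => eta /=.
  case: ifP => [mk _ x|]; last by rewrite eqxx.
  by apply: leq_trans mk; rewrite /mass (bigD1 x) //= leq_addr.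
- apply: rintegrableD.
    apply: polynomial_integrable.
    exact: (@polynomial_generator_opoly _ _ _ G tL tR 0 xi).
  apply: rintegrableZ; apply: rintegrable_sum => i _.
  apply: polynomial_integrable; apply: polynomial_transition_rate.
  exact: polynomial_multi_opoly.
- move=> k eta; rewrite /F /g !generatorE mulr_sumr -big_split /=.
  apply: le_trans (ler_norm_sum _ _ _) _; apply: ler_sum => i _.
  have r0 := transition_rate_ge0 hsigma i eta hL hR.
  rewrite normrM (ger0_norm r0) mulrCA -mulrDr ler_wpM2l //.
  have := Q0 eta; have := Q0 (transition i eta).
  by do 2!case: ifP => _; move=> ? ?; rewrite ler_norml; apply/andP; split; lra.
- move=> eta.
  (* From this mass on, the cut-off affects neither eta nor any of its targets. *)
  exists (mass eta + \sum_i mass (transition i eta))%N => // k /= hk.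
  rewrite /F !generatorE; apply: eq_bigr => i _.
  rewrite (leq_trans (leq_addr _ _) hk) ifT //.
  by apply: leq_trans hk; rewrite (bigD1 i) //= addnCA leq_addr.
Qed.

Lemma polynomial_invariant f : polynomial_fun f ->
  rintegrable mu (generator tL tR f) /\ \int[mu]_eta generator tL tR f eta = 0.
Proof.
elim=> [xi|g h _ [ig g0] _ [ih h0]|c g _ [ig g0]].
- exact: falling_invariant.
- have -> : generator tL tR (fun eta => g eta + h eta) =
      (fun eta => generator tL tR g eta + generator tL tR h eta).
    by apply/funext => eta; rewrite generatorD.
  by rewrite RintegralTD // g0 h0 addr0; split => //; exact: rintegrableD.
- have -> : generator tL tR (fun eta => c * g eta) =
      (fun eta => c * generator tL tR g eta).
    by apply/funext => eta; rewrite generatorZ.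
  by rewrite RintegralTZ // g0 mulr0; split => //; exact: rintegrableZ.
Qed.

Lemma polynomial_dual_function c xi :
  polynomial_fun (fun eta : config => dual_function c xi eta).
Proof.
apply: polynomial_ext
  (polynomialZ (weight sigma G xi)^-1
     (@polynomial_multi_opoly _ _ sigma G c xi)) => eta.
by rewrite mulrC.
Qed.

(** Integrate the duality relation with c = tR: the generator side has mean 0, and the right
    injection carries the factor tR - tR. *)
Lemma stationary_dual_solution : dual_solution sigma G (tL - tR)
  (fun xi => \int[mu]_eta dual_function tR xi eta).
Proof.
have iD xi : rintegrable mu (fun eta => dual_function tR xi eta).
  exact: (polynomial_integrable (polynomial_dual_function tR xi)).
split.
  transitivity (\int[mu]_(eta in [set: config]) (1 : R)).
    apply: eq_Rintegral => eta _; rewrite /dual_function multi_opoly_empty.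
    by rewrite /weight big1 ?divr1 // => x _; rewrite ffunE big_ord0.
  exact: Rintegral_const.
move=> xi ax _.
have [_] := polynomial_invariant (polynomial_dual_function tR xi).
move=> e; apply: etrans e.
pose J p eta := omega G p.1 p.2 * hop_rate sigma G xi p.1 p.2 *
  (dual_function tR (move p.1 p.2 xi) eta + (-1) * dual_function tR xi eta).
have iJ p : rintegrable mu (J p).
  by apply: rintegrableZ; apply: rintegrableD => //; exact: rintegrableZ.
pose b : R := (tL - tR) * (omegaL G * alphaL G * (xi ord0)%:R).
transitivity (\int[mu]_eta (\sum_p J p eta
  + ((- killing G xi) * dual_function tR xi eta
     + b * dual_function tR (remove ord0 xi) eta))); last first.
  apply: eq_Rintegral => eta _; rewrite duality // dual_generatorE.
  rewrite /injection subrr mul0r addr0 -addrA; congr (_ + _).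
    by apply: eq_bigr => p _; rewrite /J; ring.
  by rewrite /b; ring.
have i1 := rintegrableZ (- killing G xi) (iD xi).
have i2 := rintegrableZ b (iD (remove ord0 xi)).
have i0 : rintegrable mu (fun eta => \sum_p J p eta).
  by apply: rintegrable_sum => p _; exact: iJ.
rewrite (RintegralTD i0 (rintegrableD i1 i2)) (RintegralTD i1 i2).
rewrite (RintegralTZ _ (iD _)) (RintegralTZ _ (iD _)) Rintegral_sum //.
rewrite dual_generatorE /injection mul0r addr0 -addrA; congr (_ + _).
  apply: eq_bigr => p _; have i3 := rintegrableZ (-1) (iD xi).
  by rewrite RintegralTZ ?RintegralTD ?RintegralTZ //;
    [ring|exact: rintegrableD].
by rewrite /b; ring.
Qed.

End StationaryEquations.

(** * Cumulants *)

(** Transports the cumulant sum from indices to sites; taking preimages of blocks inverts taking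
    images. *)
Lemma reindex_partition_imset (I T : finType) (A : nmodType) (x : I -> T)
    (F : {set {set T}} -> A) : injective x ->
  \sum_(gamma | finset.partition gamma [set x i | i in [set: I]]%SET) F gamma =
  \sum_(gamma : {set {set I}} | finset.partition gamma [set: I]%SET)
     F [set [set x i | i in U] | U : {set I} in gamma]%SET.
Proof.
move=> xinj.
pose h (g : {set {set I}}) : {set {set T}} :=
  [set [set x i | i in U] | U : {set I} in g]%SET.
pose h' (g : {set {set T}}) : {set {set I}} :=
  [set x @^-1: U | U : {set T} in g]%SET.
have hK : cancel h h'.
  move=> g; rewrite /h /h' -imset_comp -[RHS]imset_id; apply: eq_imset => U /=.
  by apply/setP => i; rewrite finset.inE mem_imset.
rewrite (reindex_onto h h') => [|g pg].
  by apply: eq_bigl => g; rewrite imset_partition // hK eqxx andbT.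
rewrite /h /h' -imset_comp -[RHS]imset_id; apply: eq_in_imset => U Ug /=.
apply/setP => v; apply/imsetP/idP => [[i + ->]|vU].
  by rewrite finset.inE.
have /(fintype.subsetP (partitionS pg Ug))/imsetP[i _ e] := vU.
by exists i; rewrite // finset.inE -e.
Qed.

Section Cumulants.
Context (R : realType) (N : nat) (sigma : int) (G : geometry R N).
Local Notation V := 'I_N.+1.
Local Notation conf := {ffun V -> nat}.
Local Notation config := (config sigma G).
Local Notation adm := (admissible sigma G).
Local Notation dual_function := (dual_function sigma G).
Implicit Types (W : {set V}) (xi : conf) (eta : config).

Definition site_indicator W : conf := [ffun v => nat_of_bool (v \in W)].

Lemma site_indicator_admissible W : adm (site_indicator W).
Proof.
apply/admissibleP => _ v; rewrite ffunE; apply: leq_trans (alpha_gt0 G v).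
exact: leq_b1.
Qed.

Lemma mass_site_indicator W : mass (site_indicator W) = #|W|.
Proof.
by rewrite /mass -sum1_card [RHS]big_mkcond; apply: eq_bigr => v _; rewrite ffunE;
  case: ifP.
Qed.

Lemma dual_function_site_indicator c W eta :
  dual_function c (site_indicator W) eta = \prod_(v in W) (density v eta - c).
Proof.
rewrite /dual_function /multi_opoly /weight -prodf_div [RHS]big_mkcond /=.
apply: eq_bigr => v _; rewrite ffunE; case: ifP => _ /=.
  have a0 : (alpha G v)%:R != 0 :> R by rewrite pnatr_eq0 -lt0n alpha_gt0.
  rewrite big_ord1 /= mulr0 addr0 /density; field; exact: a0.
by rewrite big_ord0 divr1.
Qed.

(** The expansion of a product over W of a shifted density minus its mean, where J collects the
    sites contributing the density. The value 0 off W leaves only those J that contain the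
    complement of W. *)
Definition centered_moment (psi : conf -> R) W : R :=
  \sum_(J : {set V})
     (\prod_(v | v \notin J)
        (if v \in W then - psi (site_indicator [set v]%SET) else 0))
     * psi (site_indicator (J :&: W)%SET).

(** Partitions of the support of xi, rather than of an index set, make this a function of the
    configuration alone. *)
Definition cumulant_coef (psi : conf -> R) xi : R :=
  \sum_(gamma : {set {set V}} |
        finset.partition gamma [set v | (0 < xi v)%N]%SET)
     ((#|gamma|.-1)`!%:R * (-1) ^+ #|gamma|.-1)
     * \prod_(U in gamma) centered_moment psi U.

Context (mu : probability config R) (psi : conf -> R) (c t : R).
Context (iD : forall W,
  rintegrable mu (fun eta => dual_function c (site_indicator W) eta)).
Context (mD : forall W,
  \int[mu]_eta dual_function c (site_indicator W) eta =
  t ^+ #|W| * psi (site_indicator W)).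

Lemma thetabarE v : thetabar mu v = c + t * psi (site_indicator [set v]%SET).
Proof.
have e : @density R N sigma G v = fun eta =>
    dual_function c (site_indicator [set v]%SET) eta + c.
  by apply/funext => eta; rewrite dual_function_site_indicator big_set1 subrK.
have ic := rintegrable_cst mu c.
have -> : thetabar mu v = fine 'E_mu[fun eta : config =>
    (dual_function c (site_indicator [set v]%SET) eta + c)%R]%E by rewrite -e.
rewrite rintegrable_expectation /=; last exact: rintegrableD.
by rewrite RintegralTD // mD cards1 expr1 Rintegral_const addrC.
Qed.

(** The density minus its mean is the density minus c, minus t times a value of [psi]. After
    expansion each site of W contributes one factor t, from either the constant or the dual
    moment. *)
Lemma centered_momentE W :
  let f eta := \prod_(v in W) (density v eta - thetabar mu v) in
  rintegrable mu f /\ \int[mu]_eta f eta = t ^+ #|W| * centered_moment psi W.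
Proof.
move=> f.
pose a (J : {set V}) : R := t ^+ #|W :\: J|%SET * \prod_(v | v \notin J)
  (if v \in W then - psi (site_indicator [set v]%SET) else 0).
have fE : f = fun eta => \sum_(J : {set V})
    a J * dual_function c (site_indicator (J :&: W)%SET) eta.
  apply/funext => eta; rewrite /f big_mkcond /=.
  pose z v := density v eta - c.
  pose g v := t * psi (site_indicator [set v]%SET).
  transitivity (\prod_v ((if v \in W then z v else 1)
                         + (if v \in W then - g v else 0))).
    apply: eq_bigr => v _; case: ifP => _; last by rewrite addr0.
    by rewrite thetabarE /z /g opprD addrA.
  rewrite bigA_distr; apply: eq_bigr => J _.
  rewrite dual_function_site_indicator (bigID (mem J)) /= mulrC; congr (_ * _).
    rewrite /a -prodr_const [LHS]big_mkcond [X in _ = X * _]big_mkcond.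
    rewrite [X in _ = _ * X]big_mkcond -big_split /=; apply: eq_bigr => v _.
    rewrite finset.inE /g; case: (v \in J); case: (v \in W) => /=; ring.
  rewrite [RHS]big_mkcond [LHS]big_mkcond; apply: eq_bigr => v _.
  by rewrite finset.inE; case: (v \in J); case: (v \in W).
have ia J : rintegrable mu
    (fun eta => a J * dual_function c (site_indicator (J :&: W)%SET) eta).
  exact: rintegrableZ.
split; first by rewrite fE; apply: rintegrable_sum => J _; exact: ia.
rewrite fE Rintegral_sum // /centered_moment mulr_sumr; apply: eq_bigr => J _.
rewrite RintegralTZ // mD /a -(cardsID J W) finset.setIC exprD; ring.
Qed.

Lemma joint_cumulantE n (x : 'I_n -> V) : injective x ->
  joint_cumulant mu
    (fun (i : 'I_n) (eta : config) => density (x i) eta - thetabar mu (x i))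
  = (t ^+ n * cumulant_coef psi (sum_delta x))%:E.
Proof.
move=> xinj; rewrite /joint_cumulant.
have E (U : {set 'I_n}) :
    'E_mu[fun w => (\prod_(i in U) (density (x i) w - thetabar mu (x i)))%R]%E =
    (t ^+ #|U| * centered_moment psi [set x i | i in U]%SET)%:E.
  have [i1 e1] := centered_momentE [set x i | i in U]%SET.
  have -> : (fun w : config =>
      \prod_(i in U) (density (x i) w - thetabar mu (x i))) = fun w =>
      \prod_(v in [set x i | i in U]%SET) (density v w - thetabar mu v).
    by apply/funext => w; rewrite big_imset //= => i j _ _; exact: xinj.
  by rewrite rintegrable_expectation // e1 card_imset.
under eq_bigr do under eq_bigr do rewrite E.
under eq_bigr do rewrite prodEFin -EFinM.
rewrite sumEFin; congr EFin; rewrite /cumulant_coef.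
have -> : [set v | (0 < sum_delta x v)%N]%SET =
    [set x i | i in [set: 'I_n]]%SET.
  apply/setP => v; rewrite finset.inE ffunE lt0n sum_nat_eq0 negb_forall.
  apply/existsP/imsetP => [[i]|[i _ ->]]; last by exists i; rewrite eqxx.
  by rewrite /= eqb0 negbK => /eqP ->; exists i; rewrite ?finset.in_setT.
rewrite reindex_partition_imset // mulr_sumr; apply: eq_bigr => gamma pg.
have inj_im : injective (fun U : {set 'I_n} => [set x i | i in U]%SET).
  exact: imset_inj.
rewrite card_imset // big_imset /=; last by move=> U U' _ _; exact: inj_im.
(* The block sizes of a partition add up to n, so every partition carries the same power of t. *)
by rewrite big_split /= -expr_sum -(card_partition pg) cardsT card_ord mulrCA.
Qed.

End Cumulants.

Theorem corollary5p2 (R : realType) (N : nat) (sigma : int)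
  (hsigma : sigma \in [:: -1; 0; 1])
  (G : geometry R N)
  (hG : 0 < Num.max (omegaL G) (omegaR G)) :
  exists phi : {ffun 'I_N.+1 -> nat} -> R,
  forall (n : nat) (x : 'I_n -> 'I_N.+1), (0 < n)%N -> injective x ->
  forall thetaL thetaR : R, Theta R sigma thetaL -> Theta R sigma thetaR ->
  forall P : R -> config sigma G -> probability (config sigma G) R,
  markov_semigroup P ->
  has_generator P (@generator R N sigma G thetaL thetaR) ->
  forall mu : probability (config sigma G) R,
  stationary P mu ->
  joint_cumulant mu
    (fun (i : 'I_n) eta => density (x i) eta - thetabar mu (x i))
  = ((thetaL - thetaR) ^+ n * phi (sum_delta x))%:E.
Proof.
have [psi psiP] := dual_solution_homogeneous hsigma hG.
(* The witness is chosen before the reservoir densities are introduced, hence does not depend on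
   them. *)
exists (cumulant_coef psi) => n x _ xinj tL tR hL hR P _ gen mu st.
have inv := stationary_invariant (@config_discrete R N sigma G) gen st.
have sol := stationary_dual_solution hsigma hG hL hR inv.
apply: (@joint_cumulantE _ _ _ _ _ _ tR) => // W.
  apply: (polynomial_integrable hsigma hG hL hR inv).
  exact: polynomial_dual_function.
rewrite (psiP _ _ sol) ?mass_site_indicator //.
exact: site_indicator_admissible.
Qed.
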